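(* Let $\mathbb{K}=\mathbb{R}$ or $\mathbb{C}$ and let $\mathfrak{g}$ be an $8$-dimensional $2$-step nilpotent Lie algebra over $\mathbb{K}$ whose characteristic sequence is $(2,2,2,1,1)$. Then $\mathfrak{g}$ is symplectic if and only if it is not isomorphic to the $8$-dimensional Lie algebra over $\mathbb{K}$ whose Maurer-Cartan equations, in the dual basis $\{\alpha_1,\dots,\alpha_8\}$ of a basis of the algebra, are $$ \left\{ \begin{array}{l} d\alpha_3=-\alpha_1 \wedge \alpha_2, \\ d\alpha_5=-\alpha_1 \wedge \alpha_4, \\ d\alpha_7=-\alpha_1 \wedge \alpha_6- \alpha_2 \wedge \alpha_4-\alpha_6 \wedge \alpha_8,\\ d\alpha_i=0, \quad i=1,2,4,6,8. \end{array} \right. $$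
   Context: For a finite-dimensional Lie algebra $\mathfrak{g}$ over $\mathbb{K}$ and $\alpha\in\mathfrak{g}^*$, $d\alpha(X,Y)=-\alpha([X,Y])$; for a skew-symmetric bilinear form $\theta$, $d\theta(X,Y,Z)=\theta([X,Y],Z)+\theta([Y,Z],X)+\theta([Z,X],Y)$. A Lie algebra of dimension $2p$ is called symplectic if it admits a symplectic form, i.e. a skew-symmetric bilinear form $\theta$ with $d\theta=0$ and $\theta^p\neq 0$ (nondegenerate). The lower central series is $C^0(\mathfrak{g})=\mathfrak{g}$, $C^j(\mathfrak{g})=[\mathfrak{g},C^{j-1}(\mathfrak{g})]$; $\mathfrak{g}$ is $2$-step nilpotent if $C^2(\mathfrak{g})=0$ and $C^1(\mathfrak{g})\neq 0$. For $X\in\mathfrak{g}$, $X\ne 0$, in a nilpotent Lie algebra, $c(X)$ denotes the decreasing sequence of the sizes of the Jordan blocks of the nilpotent operator $\mathrm{ad}(X)$; the characteristic sequence of $\mathfrak{g}$ is $c(\mathfrak{g})=\max\{c(X): X\in\mathfrak{g}\setminus C^1(\mathfrak{g})\}$ for the lexicographic order. *)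

(* Defs.v *)
From HB Require Import structures.
From mathcomp Require Import all_boot all_order all_algebra.
From mathcomp Require Import reals complex.
From mathcomp Require Import ring.

Set Implicit Arguments.
Unset Strict Implicit.
Unset Printing Implicit Defensive.

Import Order.TTheory GRing.Theory.

Local Open Scope ring_scope.

HB.mixin Record Vector_isLie (K : fieldType) L of Vector K L := {
  lie_bracket : L -> L -> L;
  lie_bracket_bilinear :
    bilinear_for *:%R *:%R lie_bracket;
  lie_bracketxx : forall x, lie_bracket x x = 0;
  lie_jacobi : forall x y z,
    lie_bracket x (lie_bracket y z) + lie_bracket y (lie_bracket z x)
    + lie_bracket z (lie_bracket x y) = 0
}.

#[short(type="lieAlgType")]
HB.structure Definition LieAlgebra (K : fieldType) :=
  {L of Vector_isLie K L & Vector K L}.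

Notation "[ 'lie' x , y ]" := (lie_bracket x y)
  (at level 0, x at level 99, y at level 99, format "[ 'lie'  x ,  y ]").

HB.instance Definition _ (K : fieldType) (g : lieAlgType K) :=
  bilinear_isBilinear.Build K g g g _ _ (@lie_bracket K g)
    lie_bracket_bilinear.

Section LieTheory.
Context {K : fieldType} {g : lieAlgType K}.

Definition ad (x : g) : 'End(g) := linfun (lie_bracket x).

(* The subspace [U, V] spanned by all brackets; see lie_prodP. *)
Definition lie_prod (U V : {vspace g}) : {vspace g} :=
  <<[seq [lie x, y] | x <- vbasis U, y <- vbasis V]>>%VS.

Lemma lie_prodP (U V W : {vspace g}) :
  reflect (forall x y, x \in U -> y \in V -> [lie x, y] \in W)
          (lie_prod U V <= W)%VS.
Proof.
apply: (iffP idP) => [sW x y Ux Vy | sW]; last first.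
  apply/span_subvP => _ /allpairsP[[u v] /= [Uu Vv ->]].
  by apply: sW; exact: vbasis_mem.
rewrite (coord_vbasis Ux) (coord_vbasis Vy) linear_sumlz memv_suml// => i _.
rewrite linear_sumr memv_suml// => j _.
rewrite linearZl_LR memvZ// linearZr_LR memvZ//.
by apply: (subvP sW); rewrite memv_span// allpairs_f// mem_nth// size_tuple.
Qed.

End LieTheory.

Section LowerCentralSeries.
Context {K : fieldType} (g : lieAlgType K).

Definition lower_central (j : nat) : {vspace g} := iter j (lie_prod fullv) fullv.

Definition two_step_nilpotent : Prop :=
  lower_central 2 = 0%VS /\ lower_central 1 <> 0%VS.

End LowerCentralSeries.

(* Nilpotent Jordan block, acting on row vectors. *)
Definition jordan_block (K : fieldType) (n : nat) : 'M[K]_n :=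
  \matrix_(i, j) (j == i.+1 :> nat)%:R.

(* [jordan_type f s]: in some basis e, the matrix of f (whose i-th row contains
   the coordinates of f e_i) is block diagonal with nilpotent Jordan blocks of
   sizes s_0 >= s_1 >= ... > 0. *)
Definition jordan_type (K : fieldType) (V : vectType K) (f : 'End(V))
    (s : seq nat) : Prop :=
  [/\ sorted geq s, all (leq 1) s &
      exists2 e : (\sum_(k < size s) nth 0 s k)%N.-tuple V, basis_of {:V} e &
        let J := \mxdiag_(k < size s) jordan_block K (nth 0 s k)%N in
        forall i : 'I__, f e`_i = \sum_j J i j *: e`_j].

(* s = max {c(X) : X \notin C^1(g)}, for the lexicographic order; c(X) is only
   available as a relation, [jordan_type (ad X)]. *)
Definition is_char_seq (K : fieldType) (g : lieAlgType K) (s : seq nat) : Prop :=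
  (exists2 X : g, X \notin lower_central g 1 & jordan_type (ad X) s) /\
  (forall (X : g) (t : seq nat),
     X \notin lower_central g 1 -> jordan_type (ad X) t ->
     ((t : seqlexi nat) <= (s : seqlexi nat))%O).

Section Forms.
Context {K : fieldType} {g : lieAlgType K}.

Definition d1 (a : g -> K) : g -> g -> K := fun x y => - a [lie x, y].

Definition d2 (theta : g -> g -> K) : g -> g -> g -> K := fun x y z =>
  theta [lie x, y] z + theta [lie y, z] x + theta [lie z, x] y.

(* The convention without factor 1/2, consistent with d1. *)
Definition wedge (a b : g -> K) : g -> g -> K := fun x y => a x * b y - a y * b x.

End Forms.

(* Nondegeneracy renders theta^p <> 0, for dim g = 2p; it forces the dimension
   to be even. *)
Definition symplectic (K : fieldType) (g : lieAlgType K) : Prop :=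
  exists theta : {skew_symmetric g},
    (forall x y z, d2 theta x y z = 0) /\ nondegenerate theta.

Definition lie_isomorphic (K : fieldType) (g h : lieAlgType K) : Prop :=
  exists2 f : 'Hom(g, h), bijective f &
    forall x y, f [lie x, y] = [lie f x, f y].

(* The forms alpha_1, ..., alpha_8 of the basis dual to e are the coordinate
   functions, with a shift of the index. *)
Definition maurer_cartan8 (K : fieldType) (h : lieAlgType K)
    (e : 8.-tuple h) : Prop :=
  let alpha (k : nat) : h -> K := coord e (inord k.-1) in
  let dalpha (k : nat) := d1 (alpha k) in
  let w (k l : nat) := wedge (alpha k) (alpha l) in
  forall x y : h,
  [/\ dalpha 3%N x y = - w 1%N 2%N x y,
      dalpha 5%N x y = - w 1%N 4%N x y,
      dalpha 7%N x y = - w 1%N 6%N x y - w 2%N 4%N x y - w 6%N 8%N x y &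
      forall i, i \in [:: 1; 2; 4; 6; 8]%N -> dalpha i x y = 0].

Section Witness.
Variable K : fieldType.

Definition mc8 : Type := 'rV[K]_8.
HB.instance Definition _ := Vector.on mc8.

Definition mc8_bracket (x y : mc8) : mc8 :=
  let m (k l : nat) := x 0 (inord k.-1) * y 0 (inord l.-1)
               - x 0 (inord l.-1) * y 0 (inord k.-1) in
  \row_(i < 8) ((i == 2 :> nat)%N%:R * m 1%N 2%N + (i == 4 :> nat)%N%:R * m 1%N 4%N
                + (i == 6 :> nat)%N%:R * (m 1%N 6%N + m 2%N 4%N + m 6%N 8%N)).

Fact mc8_bracket_bilinear : bilinear_for *:%R *:%R mc8_bracket.
Proof. by split=> z a x y; apply/rowP => i; rewrite !mxE; ring. Qed.

Fact mc8_bracketxx x : mc8_bracket x x = 0.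
Proof. by apply/rowP => i; rewrite !mxE; ring. Qed.

Fact mc8_jacobi x y z :
  mc8_bracket x (mc8_bracket y z) + mc8_bracket y (mc8_bracket z x)
  + mc8_bracket z (mc8_bracket x y) = 0.
Proof. by apply/rowP => i; rewrite !mxE !inordK //=; ring. Qed.

HB.instance Definition _ := Vector_isLie.Build K mc8
  mc8_bracket_bilinear mc8_bracketxx mc8_jacobi.

Lemma maurer_cartan8_exists :
  exists (h : lieAlgType K) (e : 8.-tuple h), basis_of {:h} e /\ maurer_cartan8 e.
Proof.
pose e : 8.-tuple mc8 := [tuple delta_mx 0 i | i < 8].
have eE (i : 'I_8) : e`_i = delta_mx 0 i by rewrite -tnth_nth tnth_mktuple.
have fe : free e.
  apply/freeP => k sk0 i; move/rowP/(_ i): sk0; rewrite summxE mxE => <-.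
  rewrite (bigD1 i)//= eE !mxE !eqxx mulr1 big1 ?addr0// => j ji.
  by rewrite eE !mxE eqxx /= eq_sym (negPf ji) mulr0.
have cE i (x : mc8) : coord e i x = x 0 i.
  have -> : x = \sum_j x 0 j *: e`_j.
    by rewrite [LHS]row_sum_delta; apply: eq_bigr => j _; rewrite eE.
  rewrite coord_sum_free// summxE (bigD1 i)//= eE !mxE !eqxx mulr1 big1 ?addr0//.
  by move=> j ji; rewrite eE !mxE eqxx /= eq_sym (negPf ji) mulr0.
exists mc8, e; split.
  by rewrite basisEfree fe subvf size_tuple dimvf /dim /= !mul1n.
move=> x y; rewrite /d1 /wedge !cE !mxE !inordK //=.
split; try by ring.
move=> i; rewrite !inE => /or4P[/eqP->|/eqP->|/eqP->|/orP[/eqP->|/eqP->]];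
  rewrite cE !mxE !inordK //=; ring.
Qed.

End Witness.

(* Main.v *)
Require Import Defs.
From HB Require Import structures.
From mathcomp Require Import all_boot all_order all_algebra.
From mathcomp Require Import reals complex.
From mathcomp Require Import ring.

(** Let W = [g, g], which is central.  In a closed form theta, W is isotropic,
    because d theta (x, y, z) = theta ([x, y], z) when z is in W.  Hence theta
    is governed by the pairing B : W x g/W -> K that it induces, and closedness
    of theta says that the cyclic sum of B ([x, y], z) vanishes.  Conversely,
    when such a B is injective on W, it can be completed by a form on g/W to a
    symplectic form, since dim g is even; [coframe_symplectic] is this
    construction in coordinates.

    The characteristic sequence provides X outside W with ad X of rank 3.  The
    kernel of ad X has dimension 5 and contains W and X, and W contains the
    image of ad X, so dim W is 3 or 4 ([dim_derived]).

    If dim W = 4, the cyclic conditions are so few that a solution B can be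
    written down directly ([symplectic_coframe4]).

    If dim W = 3, take u such that ker (ad X) is spanned by X, u and W.  Then
    [X, v] |-> [u, v] is an endomorphism T of W, and replacing u by u - d X
    replaces T by T - d.  Up to such a shift, over any field, T is zero, or
    diagonal of rank one, or nilpotent of rank one, or cyclic ([normal3P]).
    Let L be the matrix of T in a basis w_i = [X, v_i] of W, and let P record
    the brackets [v_i, v_j].  A symmetric invertible matrix S with L S
    symmetric and tr (P S) = 0 gives a symplectic form for which B (w, X) = 0
    ([coframe_symplectic_sym]).  Such an S exists except for very special P.
    After a change of the lifts v_i modulo X and u ([coframe_shift]) these P
    take a simple shape.  In the nilpotent and cyclic cases there is then a B
    with B (w, X) <> 0; in the diagonal case the algebra is the excluded one
    ([symplectic_semisimple], [mc8_isomorphic]).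

    The excluded algebra has no symplectic form: closedness forces
    theta (e_7, _) = 0 ([mc8_not_symplectic]). *)

Set Implicit Arguments.
Unset Strict Implicit.
Unset Printing Implicit Defensive.

Import Order.TTheory GRing.Theory.
Local Open Scope ring_scope.

(** * Triples *)

Local Notation o0 := (@Ordinal 3 0 isT).
Local Notation o1 := (@Ordinal 3 1 isT).
Local Notation o2 := (@Ordinal 3 2 isT).

Lemma forall_ord3 (Q : 'I_3 -> Prop) : Q o0 -> Q o1 -> Q o2 -> forall i, Q i.
Proof.
move=> Q0 Q1 Q2 [[|[|[|//]]] lti].
- by rewrite (_ : Ordinal lti = o0)//; apply: val_inj.
- by rewrite (_ : Ordinal lti = o1)//; apply: val_inj.
- by rewrite (_ : Ordinal lti = o2)//; apply: val_inj.
Qed.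

Lemma sum_ord3 (V : nmodType) (F : 'I_3 -> V) :
  \sum_i F i = F o0 + F o1 + F o2.
Proof.
rewrite !big_ord_recl big_ord0 addr0 addrA.
by congr (_ + _ + _); congr F; apply: val_inj.
Qed.

(** * Forms in Darboux shape *)

Section Darboux.
Context {K : fieldType} {g : lieAlgType K}.

Section DarbouxForm.
Variables (n : nat) (p q : 'I_n -> g -> K).

Definition darboux (x y : g) : K := \sum_i wedge (p i) (q i) x y.

Hypothesis p_lin : forall i, scalar (p i).
Hypothesis q_lin : forall i, scalar (q i).

Lemma darboux_skew x y : darboux x y = (-1) ^+ true * idfun (darboux y x).
Proof.
rewrite expr1 mulN1r /darboux -sumrN; apply: eq_bigr => i _.
by rewrite /wedge/= opprB.
Qed.

Lemma darboux_bilinear : bilinear_for *%R (idfun \; *%R) darboux.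
Proof.
split=> z k x y; rewrite /= /darboux mulr_sumr -big_split /=.
  by apply: eq_bigr => i _; rewrite /wedge p_lin q_lin; ring.
by apply: eq_bigr => i _; rewrite /wedge p_lin q_lin; ring.
Qed.

HB.instance Definition _ := bilinear_isBilinear.Build K g g K
  (GRing.Scale.Law.clone _ _ ( *%R ) _)
  (GRing.Scale.Law.clone _ _ (idfun \; *%R ) _) darboux darboux_bilinear.
HB.instance Definition _ :=
  isHermitianSesquilinear.Build K g true idfun darboux darboux_skew.

Definition darboux_form : {skew_symmetric g} := darboux.

Definition darboux_map (x : g) : 'rV[K]_(n + n) :=
  row_mx (\row_i p i x) (\row_i q i x).

Lemma darboux_map_linear : linear darboux_map.
Proof.
move=> k x y; apply/rowP => i; rewrite !mxE.
by case: split => j; rewrite !mxE ?p_lin ?q_lin.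
Qed.
HB.instance Definition _ := GRing.isSemilinear.Build K g 'rV[K]_(n + n) _
  darboux_map (GRing.semilinear_linear darboux_map_linear).

Lemma darboux_nondegenerate :
  \dim {:g} = n.*2 ->
  (forall x, (forall i, p i x = 0) -> (forall i, q i x = 0) -> x = 0) ->
  nondegenerate darboux_form.
Proof.
move=> dim_g inj_pq.
pose F : 'Hom(g, 'rV[K]_(n + n)) := linfun darboux_map.
have kerF : lker F == 0%VS.
  apply/lker0P => x y; rewrite !lfunE /= => Fxy; apply/eqP.
  rewrite -subr_eq0; apply/eqP.
  have pl i : p i (x - y) = p i x - p i y.
    by rewrite addrC -scaleN1r p_lin mulN1r addrC.
  have ql i : q i (x - y) = q i x - q i y.
    by rewrite addrC -scaleN1r q_lin mulN1r addrC.
  have [/rowP px /rowP qx] := eq_row_mx Fxy.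
  apply: inj_pq => i; [move: (px i)|move: (qx i)]; rewrite !mxE => E.
    by rewrite pl E subrr.
  by rewrite ql E subrr.
have imF : limg F = fullv.
  apply/eqP; rewrite eqEdim subvf /= limg_dim_eq; last first.
    by rewrite (eqP kerF) capv0.
  by rewrite dim_g dimvf /dim /= mul1n addnn.
have surj (r : 'rV_(n + n)) : exists x, darboux_map x = r.
  have /memv_imgP[x _ ->] : r \in limg F by rewrite imF memvf.
  by exists x; rewrite lfunE.
apply/eqP/vspaceP => x; rewrite memv0; apply/idP/idP; last first.
  by move/eqP->; rewrite mem0v.
move=> /mem_orthovP x_rad; apply/eqP.
have rad0 y : darboux x y = 0 by apply: x_rad; rewrite memvf.
apply: inj_pq => i.
  have [y Fy] := surj (row_mx 0 (delta_mx 0 i)).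
  have [/rowP py /rowP qy] := eq_row_mx Fy.
  rewrite -(rad0 y) /darboux (bigD1 i) //= big1 => [|j ji]; rewrite /wedge.
    move: (py i) (qy i); rewrite !mxE !eqxx => -> ->.
    by rewrite mul0r mulr1 subr0 addr0.
  move: (py j) (qy j); rewrite !mxE (negPf ji) => -> ->.
  by rewrite mul0r mulr0 subr0.
have [y Fy] := surj (row_mx (delta_mx 0 i) 0).
have [/rowP py /rowP qy] := eq_row_mx Fy.
apply/eqP; rewrite -oppr_eq0 -(rad0 y); apply/eqP.
rewrite /darboux (bigD1 i) //= big1 => [|j ji]; rewrite /wedge.
  move: (py i) (qy i); rewrite !mxE !eqxx => -> ->.
  by rewrite mulr0 mul1r sub0r addr0.
move: (py j) (qy j); rewrite !mxE (negPf ji) => -> ->.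
by rewrite mul0r mulr0 subr0.
Qed.

End DarbouxForm.

(** The 2n forms [p i], [q i] separate points, so they are a basis of the dual
    of g, and the sum of the [p i] ^ [q i] is nondegenerate.  Only closedness
    remains to be checked. *)
Lemma symplectic_darboux (n : nat) (p q : 'I_n -> g -> K) :
  \dim {:g} = n.*2 ->
  (forall i, scalar (p i)) -> (forall i, scalar (q i)) ->
  (forall x, (forall i, p i x = 0) -> (forall i, q i x = 0) -> x = 0) ->
  (forall x y z, d2 (fun x y => \sum_i wedge (p i) (q i) x y) x y z = 0) ->
  symplectic g.
Proof.
move=> dim_g p_lin q_lin inj_pq closed.
exists (darboux_form p_lin q_lin); split; first exact: closed.
exact: darboux_nondegenerate.
Qed.

End Darboux.

(** * Coframes and the pairing criterion *)

Section Coframe.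
Context {K : fieldType} {g : lieAlgType K}.

(** A 2-form in b_0, b_1, b_2, whose coefficients are indexed by the missing
    index: coefficient i belongs to b_(i+1) ^ b_(i+2), indices modulo 3. *)
Definition wedge_row (P : 'rV[K]_3) (b : 'I_3 -> g -> K) (x y : g) : K :=
  P 0 o0 * wedge (b o1) (b o2) x y + P 0 o1 * wedge (b o2) (b o0) x y
  + P 0 o2 * wedge (b o0) (b o1) x y.

(** The forms a, c, b_i, w_i are the dual basis of X, u, v_i, [X, v_i].  Row i
    of L lists the coordinates of [u, v_i] on the [X, v_j], row i of P those of
    [v_(i+1), v_(i+2)], and E the coordinates of the latter on u.  One format
    serves both dimensions of the derived algebra: if it has dimension 4, then
    u is its fourth basis vector and L = 0; if it has dimension 3, E = 0. *)
Record coframe (a c : g -> K) (b w : 'I_3 -> g -> K)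
    (E : 'rV[K]_3) (L P : 'M[K]_3) : Prop := Coframe {
  coframe_a_lin : scalar a;
  coframe_c_lin : scalar c;
  coframe_b_lin : forall i, scalar (b i);
  coframe_w_lin : forall i, scalar (w i);
  coframe_inj : forall x, a x = 0 -> c x = 0 -> (forall i, b i x = 0) ->
    (forall i, w i x = 0) -> x = 0;
  coframe_a : forall x y, a [lie x, y] = 0;
  coframe_b : forall i x y, b i [lie x, y] = 0;
  coframe_c : forall x y, c [lie x, y] = wedge_row E b x y;
  coframe_w : forall k x y, w k [lie x, y] =
    wedge a (b k) x y + \sum_i L i k * wedge c (b i) x y
    + wedge_row (col k P)^T b x y
}.

(** The skew-symmetric part S - S^T, read as a vector with the index convention
    of [wedge_row]. *)
Definition skew_part (S : 'M[K]_3) : 'cV[K]_3 :=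
  \col_i (if i == o0 then S o1 o2 - S o2 o1 else
          if i == o1 then S o2 o0 - S o0 o2 else S o0 o1 - S o1 o0).

(** The matrix S and the column t give the pairing: B (w_k, v_j) = S k j and
    B (w_k, X) = t k.  Closedness on (X, v_i, u) forces B (w_k, u) to be entry k
    of L t.  The three equations are closedness on the triples (X, v_i, v_j),
    (u, v_i, v_j) and (v_0, v_1, v_2), and the last hypothesis says that B is
    injective on the derived algebra. *)
Lemma coframe_symplectic a c b w L P (S : 'M_3) (t : 'cV_3) :
  \dim {:g} = 8%N -> coframe a c b w 0 L P ->
  skew_part S + P *m t = 0 -> skew_part (L *m S) + P *m (L *m t) = 0 ->
  \tr (P *m S) = 0 ->
  (forall v : 'rV_3, v *m S = 0 -> v *m t = 0 -> v *m (L *m t) = 0 -> v = 0) ->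
  symplectic g.
Proof.
move=> dim_g [a_lin c_lin b_lin w_lin inj a_br b_br c_br w_br] C1 C2 C3 Binj.
pose B : 'M[K]_(3, 3 + (1 + 1)) := row_mx S (row_mx t (L *m t)).
pose F x : 'cV[K]_(3 + (1 + 1)) :=
  col_mx (\col_i b i x) (col_mx (a x)%:M (c x)%:M).
have F_lin k x y i : F (k *: x + y) i 0 = k * F x i 0 + F y i 0.
  rewrite !mxE; case: split => j; rewrite !mxE ?b_lin//.
  by case: split => l; rewrite !mxE !ord1 eqxx !mulr1n ?a_lin ?c_lin.
have F_br x y : F [lie x, y] = 0.
  apply/colP => i; rewrite !mxE; case: split => j; rewrite !mxE ?b_br//.
  case: split => l; rewrite !mxE ?a_br ?c_br ?mul0rn//.
  by rewrite /wedge_row !mxE !mul0r !addr0 mul0rn.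
have MF_lin m (M : 'M_(m, 3 + (1 + 1))) i : scalar (fun x => (M *m F x) i 0).
  move=> k x y; rewrite !mxE mulr_sumr -big_split /=; apply: eq_bigr => j _.
  by rewrite F_lin mulrDr mulrCA.
have rankB : \rank B = 3%N.
  apply/eqP; rewrite -/(row_free _) -kermx_eq0; apply/eqP/row_matrixP => i.
  rewrite row0; have /eqP : row i (kermx B) *m B = 0.
    by rewrite -row_mul mulmx_ker row0.
  rewrite !mul_mx_row !row_mx_eq0 => /and3P[/eqP ? /eqP ? /eqP ?].
  exact: Binj.
(* The two rows of C complete B to five independent forms on g / [g, g];
   they are paired with each other in the Darboux form. *)
have [C eqC] : exists C : 'M_(2, _), (C :=: B^C)%MS.
  have rankC : \rank (B^C)%MS = 2%N by rewrite mxrank_compl rankB.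
  exists (castmx (rankC, erefl) (row_base (B^C)%MS)).
  exact: eqmx_trans (eqmx_cast _ _) (eq_row_base _).
have colE (r : K) (i : 'I_1) : (\col_(_ < 1) r) i 0 = r by rewrite mxE.
have colwE x i : (\col_i w i x) i 0 = w i x by rewrite mxE.
pose p (i : 'I_(3 + 1)) x :=
  col_mx (B *m F x) (\col_(_ < 1) (C *m F x) 0 0) i 0.
pose q (i : 'I_(3 + 1)) x :=
  col_mx (\col_i w i x) (\col_(_ < 1) (C *m F x) ord_max 0) i 0.
apply: (@symplectic_darboux K g (3 + 1) p q) => //.
- move=> i k x y; rewrite -(splitK i) /p; case: (split i) => j.
    by rewrite !col_mxEu; apply: MF_lin.
  by rewrite !col_mxEd !colE; apply: MF_lin.
- move=> i k x y; rewrite -(splitK i) /q; case: (split i) => j.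
    by rewrite !col_mxEu !colwE w_lin.
  by rewrite !col_mxEd !colE; apply: MF_lin.
- move=> x px qx.
  have BF : B *m F x = 0.
    apply/colP => i; have := px (lshift 1 i); rewrite /p col_mxEu => ->.
    by rewrite mxE.
  have CF : C *m F x = 0.
    apply/colP => i; rewrite [RHS]mxE; have [->|->] : i = 0 \/ i = ord_max.
      by case: i => [[|[|//]] lti]; [left|right]; apply: val_inj.
      by have := px (rshift 3 0); rewrite /p col_mxEd colE.
    by have := qx (rshift 3 0); rewrite /q col_mxEd colE.
  have F0 : F x = 0.
    have /row_fullP[D DBC] : row_full (col_mx B C).
      rewrite -sub1mx -addsmxE (adds_eqmx (eqmx_refl B) eqC).
      by rewrite sub1mx addsmx_compl_full.
    by rewrite -[F x]mul1mx -DBC -mulmxA mul_col_mx BF CF col_mx0 mulmx0.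
  move/eqP: F0; rewrite !col_mx_eq0.
  case/and3P=> /eqP/colP b0 /eqP/colP a0 /eqP/colP c0.
  apply: inj.
  + by have := a0 0; rewrite !mxE eqxx.
  + by have := c0 0; rewrite !mxE eqxx.
  + by move=> i; have := b0 i; rewrite !mxE.
  + by move=> i; have := qx (lshift 1 i); rewrite /q col_mxEu mxE.
move=> x y z.
have mx0E m (i : 'I_m) : (0 : 'cV[K]_m) i 0 = 0 by rewrite mxE.
have th u v s : \sum_i wedge (p i) (q i) [lie u, v] s
    = - \sum_(k < 3) (B *m F s) k 0 * w k [lie u, v].
  rewrite big_split_ord big_ord1 -sumrN /= [X in _ + X](_ : _ = 0) ?addr0.
    apply: eq_bigr => k _.
    by rewrite /wedge /p /q !col_mxEu F_br mulmx0 !colwE mx0E mul0r sub0r.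
  by rewrite /wedge /p /q !col_mxEd !colE F_br !mulmx0 !mx0E; ring.
have BF s k : (B *m F s) k 0 =
    \sum_j S k j * b j s + t k 0 * a s + (\sum_j L k j * t j 0) * c s.
  rewrite /B /F mul_row_col mul_row_col !mxE addrA; congr (_ + _ + _).
  - by apply: eq_bigr => j _; rewrite mxE.
  - by rewrite big_ord1 !mxE eqxx mulr1n.
  - by rewrite big_ord1 !mxE eqxx mulr1n.
(* D f1 f2 f3 is f1 ^ f2 ^ f3 at (x, y, z); the contributions of the triples
   (a, b_k, c) cancel by the choice of the c-component of B. *)
pose D (f1 f2 f3 : g -> K) := f1 x * wedge f2 f3 y z + f1 y * wedge f2 f3 z x
  + f1 z * wedge f2 f3 x y.
transitivity (- (
    D a (b o1) (b o2) * (skew_part S + P *m t) o0 0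
  + D a (b o2) (b o0) * (skew_part S + P *m t) o1 0
  + D a (b o0) (b o1) * (skew_part S + P *m t) o2 0
  + D c (b o1) (b o2) * (skew_part (L *m S) + P *m (L *m t)) o0 0
  + D c (b o2) (b o0) * (skew_part (L *m S) + P *m (L *m t)) o1 0
  + D c (b o0) (b o1) * (skew_part (L *m S) + P *m (L *m t)) o2 0
  + D (b o0) (b o1) (b o2) * \tr (P *m S))).
  rewrite /d2 !th !sum_ord3 !BF !w_br /D /mxtrace /wedge_row /wedge.
  by do 4! rewrite ?sum_ord3 ?mxE /=; ring.
by rewrite C1 C2 C3 !mx0E; ring.
Qed.
End Coframe.

(** * Change of lifts, and symmetric pairings *)

Section Mx3.
Context {K : fieldType}.

Definition mx3 (r : seq (seq K)) : 'M[K]_3 :=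
  \matrix_(i, j) nth 0 (nth [::] r i) j.
Definition cv3 (r : seq K) : 'cV[K]_3 := \col_i nth 0 r i.

(** Column k lists the coefficients of the 2-form (sum of the s_j b_j) ^ b_k,
    in the convention of [wedge_row]. *)
Definition cross (s : 'I_3 -> K) : 'M[K]_3 :=
  mx3 [:: [:: 0; - s o2; s o1]; [:: s o2; 0; - s o0]; [:: - s o1; s o0; 0]].

Lemma det_mx33 (A : 'M[K]_3) : \det A =
  A o0 o0 * (A o1 o1 * A o2 o2 - A o1 o2 * A o2 o1)
  - A o0 o1 * (A o1 o0 * A o2 o2 - A o1 o2 * A o2 o0)
  + A o0 o2 * (A o1 o0 * A o2 o1 - A o1 o1 * A o2 o0).
Proof.
pose f (i j : nat) := A (inord i) (inord j).
have fE i j : A i j = f i j by rewrite /f !inord_val.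
rewrite (expand_det_row _ o0) sum_ord3 /cofactor.
do 3! rewrite (expand_det_row _ ord0) !big_ord_recl big_ord0 /cofactor
  !det_mx11.
by rewrite !mxE !fE /= /bump /=; ring.
Qed.

End Mx3.

Section CoframeCases.
Context {K : fieldType} {g : lieAlgType K}.
Hypothesis dim_g : \dim {:g} = 8%N.

(** The dual basis after v_i is replaced by v_i + s_i X + r_i u.  This changes
    neither the w_i = [X, v_i] nor L, only the brackets of the v_i. *)
Lemma coframe_shift (a c : g -> K) b w L P (s r : 'I_3 -> K) :
  coframe a c b w 0 L P ->
  coframe (fun x => a x - \sum_i s i * b i x)
    (fun x => c x - \sum_i r i * b i x) b w 0 L (P + cross s + cross r *m L).
Proof.
case=> a_lin c_lin b_lin w_lin inj a_br b_br c_br w_br; split => //.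
- by move=> k x y; rewrite a_lin !sum_ord3 !b_lin; ring.
- by move=> k x y; rewrite c_lin !sum_ord3 !b_lin; ring.
- move=> x ax cx bx wx.
  have b0 (f : 'I_3 -> K) : \sum_i f i * b i x = 0.
    by apply: big1 => i _; rewrite bx mulr0.
  by apply: inj => //; [move: ax|move: cx]; rewrite b0 subr0.
- by move=> x y; rewrite a_br big1 ?subr0// => i _; rewrite b_br mulr0.
- move=> x y; rewrite c_br big1 ?subr0// => i _; rewrite b_br mulr0//.
- move=> k x y; rewrite w_br /wedge_row /wedge.
  by move: k; apply: forall_ord3; do 3! rewrite ?sum_ord3 ?mxE /=; ring.
Qed.

(** The case t = 0 of [coframe_symplectic]: for symmetric S and L S only the
    closedness on (v_0, v_1, v_2) is left. *)
Lemma coframe_symplectic_sym (a c : g -> K) b w L P (S : 'M_3) :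
  coframe a c b w 0 L P -> S^T = S -> (L *m S)^T = L *m S ->
  \tr (P *m S) = 0 -> \det S != 0 -> symplectic g.
Proof.
have skew0 (M : 'M[K]_3) : M^T = M -> skew_part M = 0.
  move=> /matrixP symM; apply/colP => i; rewrite !mxE.
  by do !case: ifP => _; apply/eqP; rewrite subr_eq0 -symM mxE.
move=> cof symS symLS trPS detS.
apply: (coframe_symplectic (S := S) (t := 0) dim_g cof) => //.
- by rewrite mulmx0 addr0 skew0.
- by rewrite !mulmx0 addr0 skew0.
move=> v vS _ _; have Sunit : S \in unitmx by rewrite unitmxE unitfE.
by rewrite -[v](mulmxK Sunit) vS mul0mx.
Qed.

End CoframeCases.

Ltac mx3_unfold := do 4! rewrite ?sum_ord3 ?mxE /=.
Ltac mx3_ring := apply/matrixP; do 2! apply: forall_ord3; mx3_unfold; ring.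
Ltac tr_field := rewrite /mxtrace; mx3_unfold; field.

(** * Derived algebra of dimension three, T of rank at most one *)

Section NonCyclicCases.
Context {K : fieldType} {g : lieAlgType K}.
Hypothesis dim_g : \dim {:g} = 8%N.
Variables (a c : g -> K) (b w : 'I_3 -> g -> K).
Implicit Types P : 'M[K]_3.

Lemma det3_neq0 (S : 'M[K]_3) d : \det S = d -> d != 0 -> \det S != 0.
Proof. by move=> ->. Qed.

Lemma neq0N1 : (- 1 : K) != 0.
Proof. by rewrite oppr_eq0 oner_eq0. Qed.

Ltac det3 d := apply: (det3_neq0 (d := d));
  [by rewrite det_mx33; mx3_unfold; ring
  |by rewrite ?(mulf_neq0, invr_neq0, oppr_eq0, oner_eq0, neq0N1, sqrf_eq0)].

(** The condition tr (P S) = 0 cuts a hyperplane out of the symmetric matrices,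
    and such a hyperplane always contains an invertible matrix.  If a diagonal
    entry of P is nonzero, the corresponding diagonal entry of S absorbs the
    trace; otherwise S = 1. *)
Lemma symplectic_zero P : coframe a c b w 0 0 P -> symplectic g.
Proof.
move=> cof.
have sym S : S^T = S -> \tr (P *m S) = 0 -> \det S != 0 -> symplectic g.
  by move=> S1; apply: (coframe_symplectic_sym dim_g cof) => //;
     rewrite mul0mx trmx0.
have [P0|P0] := eqVneq (P o0 o0) 0; last first.
  apply: (sym (mx3 [:: [:: - (P o0 o1 + P o1 o0 + P o2 o2) / P o0 o0; 1; 0];
                       [:: 1; 0; 0]; [:: 0; 0; 1]])).
  - by mx3_ring.
  - by tr_field.
  - by det3 (-1 : K).
have [P1|P1] := eqVneq (P o1 o1) 0; last first.
  apply: (sym (mx3 [:: [:: 1; 0; 0];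
     [:: 0; - (P o0 o0 + P o1 o2 + P o2 o1) / P o1 o1; 1]; [:: 0; 1; 0]])).
  - by mx3_ring.
  - by tr_field.
  - by det3 (-1 : K).
have [P2|P2] := eqVneq (P o2 o2) 0; last first.
  apply: (sym (mx3 [:: [:: 0; 0; 1]; [:: 0; 1; 0];
     [:: 1; 0; - (P o0 o2 + P o2 o0 + P o1 o1) / P o2 o2]])).
  - by mx3_ring.
  - by tr_field.
  - by det3 (-1 : K).
apply: (sym 1%:M); first exact: trmx1.
  by rewrite mulmx1 /mxtrace sum_ord3 P0 P1 P2 !addr0.
by rewrite det1 oner_eq0.
Qed.

(** Symmetry of L S means that S is block diagonal of type 2 + 1.  The condition
    tr (P S) = 0 then excludes invertible S only if the last diagonal entry of P
    is nonzero and the upper left 2 x 2 block of P is skew-symmetric with zero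
    diagonal; a change of lifts clears all other entries of P. *)
Lemma symplectic_semisimple P k : k != 0 ->
  coframe a c b w 0 (mx3 [:: [::]; [::]; [:: 0; 0; k]]) P ->
  symplectic g \/ exists a' c' p, p != 0 /\
    coframe a' c' b w 0 (mx3 [:: [::]; [::]; [:: 0; 0; k]])
      (mx3 [:: [::]; [::]; [:: 0; 0; p]]).
Proof.
move=> k0 cof.
pose S x y z s := mx3 [:: [:: x; y; 0]; [:: y; z; 0]; [:: 0; 0; s]] : 'M[K]_3.
have sym x y z s :
    P o0 o0 * x + (P o0 o1 + P o1 o0) * y + P o1 o1 * z + P o2 o2 * s = 0 ->
    (x * z - y ^+ 2) * s != 0 -> symplectic g.
  move=> trPS detS; apply: (coframe_symplectic_sym (S := S x y z s) dim_g cof).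
  - by mx3_ring.
  - by mx3_ring.
  - by rewrite -trPS /mxtrace; mx3_unfold; ring.
  - by apply: (det3_neq0 _ detS); rewrite det_mx33; mx3_unfold; ring.
have [P0|P0] := eqVneq (P o0 o0) 0; last first.
  left; apply: (sym (- (P o0 o1 + P o1 o0 + P o2 o2) / P o0 o0) 1 0 1).
    by field.
  by rewrite mulr0 expr1n sub0r mulr1 neq0N1.
have [P1|P1] := eqVneq (P o1 o1) 0; last first.
  left; apply: (sym 0 1 (- (P o0 o1 + P o1 o0 + P o2 o2) / P o1 o1) 1).
    by field.
  by rewrite mul0r expr1n sub0r mulr1 neq0N1.
have [P2|P2] := eqVneq (P o2 o2) 0.
  left; apply: (sym 1 0 1 1); first by rewrite P0 P1 P2; ring.
  by rewrite expr0n subr0 !mulr1 oner_eq0.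
have [B0|B0] := eqVneq (P o0 o1 + P o1 o0) 0; last first.
  left; apply: (sym 0 (- P o2 o2 / (P o0 o1 + P o1 o0)) 0 1).
    by field.
  by rewrite mul0r sub0r mulr1 oppr_eq0 sqrf_eq0 mulf_neq0 ?oppr_eq0 ?invr_eq0.
right.
pose s i : K :=
  if i == o0 then - P o2 o1 else if i == o1 then P o2 o0 else P o0 o1.
pose r i : K := if i == o0 then (P o1 o2 + P o2 o1) / k
  else if i == o1 then - (P o0 o2 + P o2 o0) / k else 0.
exists (fun x => a x - \sum_i s i * b i x), (fun x => c x - \sum_i r i * b i x).
exists (P o2 o2); split=> //.
suff <- : P + cross s + cross r *m mx3 [:: [::]; [::]; [:: 0; 0; k]]
    = mx3 [:: [::]; [::]; [:: 0; 0; P o2 o2]] by exact: coframe_shift.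
have P10 : P o1 o0 = - P o0 o1 by apply/eqP; rewrite -addr_eq0 addrC B0.
by apply/matrixP; do 2! apply: forall_ord3; rewrite /s /r; mx3_unfold;
  rewrite ?P0 ?P1 ?P10; field.
Qed.

(** Symmetry of L S means S_11 = S_12 = 0 (indices from 0), and then the
    determinant is - S_01^2 S_22.  So tr (P S) = 0 has no invertible solution
    exactly if the trace depends on one of S_01 and S_22 alone.  These two
    exceptional P have a solution with t <> 0 after a change of lifts. *)
Lemma symplectic_nilpotent P :
  coframe a c b w 0 (mx3 [:: [:: 0; 1; 0]; [::]; [::]]) P -> symplectic g.
Proof.
set L := mx3 _; move=> cof.
pose S x y z s := mx3 [:: [:: x; y; z]; [:: y; 0; 0]; [:: z; 0; s]] : 'M[K]_3.
have sym x y z s : P o0 o0 * x + (P o0 o1 + P o1 o0) * y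
      + (P o0 o2 + P o2 o0) * z + P o2 o2 * s = 0 ->
    - y ^+ 2 * s != 0 -> symplectic g.
  move=> trPS detS; apply: (coframe_symplectic_sym (S := S x y z s) dim_g cof).
  - by mx3_ring.
  - by mx3_ring.
  - by rewrite -trPS /mxtrace; mx3_unfold; ring.
  - by apply: (det3_neq0 _ detS); rewrite det_mx33; mx3_unfold; ring.
have [P0|P0] := eqVneq (P o0 o0) 0; last first.
  apply: (sym (- (P o0 o1 + P o1 o0 + P o2 o2) / P o0 o0) 1 0 1).
    by field.
  by rewrite expr1n mulr1 neq0N1.
have [P1|P1] := eqVneq (P o0 o2 + P o2 o0) 0; last first.
  apply: (sym 0 1 (- (P o0 o1 + P o1 o0 + P o2 o2) / (P o0 o2 + P o2 o0)) 1).
    by field.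
  by rewrite expr1n mulr1 neq0N1.
have P20 : P o2 o0 = - P o0 o2 by apply/eqP; rewrite -addr_eq0 addrC P1.
have shift s r := coframe_shift s r cof.
have [P2|P2] := eqVneq (P o2 o2) 0;
  have [B0|B0] := eqVneq (P o0 o1 + P o1 o0) 0.
- apply: (sym 0 1 0 1); first by rewrite P0 P1 P2 B0; ring.
  by rewrite expr1n mulr1 neq0N1.
- pose s i : K := if i == o0 then P o1 o2 else
    if i == o1 then - P o0 o2 else - P o1 o0.
  pose r i : K := if i == o0 then 0 else
    if i == o1 then P o2 o1 + P o1 o2 else - P o1 o1.
  have {}cof := shift s r; set P' := P + _ + _ in cof.
  have P'E : P' = mx3 [:: [:: 0; P o0 o1 + P o1 o0; 0]; [::]; [::]].
    by apply/matrixP; do 2! apply: forall_ord3; rewrite /P' /L /s /r;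
       mx3_unfold; rewrite ?P0 ?P20 ?P2; ring.
  rewrite {}P'E in cof.
  apply: (coframe_symplectic
    (S := mx3 [:: [::]; [::]; [:: 0; P o0 o1 + P o1 o0; 0]])
    (t := cv3 [:: 0; 1; 0]) dim_g cof).
  + by apply/colP; apply: forall_ord3; mx3_unfold; ring.
  + by apply/colP; apply: forall_ord3; mx3_unfold; ring.
  + by rewrite /mxtrace; mx3_unfold; ring.
  move=> v /rowP vS /rowP vt /rowP vLt.
  move: (vS o1) (vt 0) (vLt 0); mx3_unfold.
  rewrite !(mulr0, mulr1, add0r, addr0, mul0r, mul1r) => /eqP.
  rewrite mulf_eq0 (negPf B0) orbF => /eqP v2 v1 v0.
  by apply/rowP; apply: forall_ord3; rewrite mxE.
- pose s i : K := if i == o0 then P o1 o2 else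
    if i == o1 then - P o0 o2 else P o0 o1.
  pose r i : K := if i == o0 then 0 else
    if i == o1 then P o2 o1 + P o1 o2 else - P o1 o1.
  have P10 : P o1 o0 = - P o0 o1 by apply/eqP; rewrite -addr_eq0 addrC B0.
  have {}cof := shift s r; set P' := P + _ + _ in cof.
  have P'E : P' = mx3 [:: [::]; [::]; [:: 0; 0; P o2 o2]].
    by apply/matrixP; do 2! apply: forall_ord3; rewrite /P' /L /s /r;
       mx3_unfold; rewrite ?P0 ?P20 ?P10; ring.
  rewrite {}P'E in cof.
  apply: (coframe_symplectic (S := mx3 [:: [::]; [:: P o2 o2; 0; 0]; [::]])
    (t := cv3 [:: 0; 1; 1]) dim_g cof).
  + by apply/colP; apply: forall_ord3; mx3_unfold; ring.
  + by apply/colP; apply: forall_ord3; mx3_unfold; ring.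
  + by rewrite /mxtrace; mx3_unfold; ring.
  move=> v /rowP vS /rowP vt /rowP vLt.
  move: (vS o0) (vt 0) (vLt 0); mx3_unfold.
  rewrite !(mulr0, mulr1, add0r, addr0, mul0r, mul1r) => /eqP.
  rewrite mulf_eq0 (negPf P2) orbF => /eqP v1; rewrite v1 add0r => v2 v0.
  by apply/rowP; apply: forall_ord3; rewrite mxE.
- apply: (sym 0 1 0 (- (P o0 o1 + P o1 o0) / P o2 o2)); first by field.
  by rewrite expr1n mulf_neq0 ?neq0N1// mulf_neq0 ?oppr_eq0 ?invr_eq0.
Qed.

End NonCyclicCases.

(** * Derived algebra of dimension three, T cyclic *)

Section CyclicCase.
Context {K : fieldType} {g : lieAlgType K}.
Hypothesis dim_g : \dim {:g} = 8%N.
Implicit Types (a c : g -> K) (b w : 'I_3 -> g -> K).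

Section Companion.
Variables (l0 l1 l2 : K).
Let L : 'M[K]_3 := mx3 [:: [:: 0; 1; 0]; [:: 0; 0; 1]; [:: l0; l1; l2]].

(** With T w_0 = w_1 and T w_1 = w_2, the six parameters of a change of lifts
    are just enough to make [v_0, v_1] and [v_0, v_2] vanish. *)
Lemma coframe_cyclic_normal a c b w P : coframe a c b w 0 L P ->
  exists a' c' z0 z1 z2,
    coframe a' c' b w 0 L (mx3 [:: [:: z0; z1; z2]; [::]; [::]]).
Proof.
move=> cof.
pose s0 := P o1 o2 + P o2 o2 * l2; pose r0 := - P o2 o2.
pose s i : K := if i == o0 then s0 else
  if i == o1 then P o2 o0 else - P o1 o0 + r0 * l0.
pose r i : K := if i == o0 then r0 else
  if i == o1 then s0 + P o2 o1 else - P o1 o1 + r0 * l1.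
have := coframe_shift s r cof; set P' := P + _ + _ => cof'.
exists (fun x => a x - \sum_i s i * b i x),
  (fun x => c x - \sum_i r i * b i x), (P' o0 o0), (P' o0 o1), (P' o0 o2).
suff <- : P' = mx3 [:: [:: P' o0 o0; P' o0 o1; P' o0 o2]; [::]; [::]].
  exact: cof'.
apply/matrixP; apply: forall_ord3; apply: forall_ord3; rewrite ?[RHS]mxE //=;
  rewrite /P' /s /r /s0 /r0 /L; mx3_unfold; ring.
Qed.

(** Identify W with the algebra K[T] by w_i = T^i, and [v_1, v_2] with
    z = z0 + z1 T + z2 T^2.  Symmetric S with L S symmetric are the Hankel
    matrices S_ij = f (T^(i+j)) of the linear forms f on K[T], and tr (P S) is
    f (z).  Here f_i = f (T^i), where f_3 and f_4 come from the characteristic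
    polynomial T^3 - l2 T^2 - l1 T - l0. *)
Lemma coframe_cyclic_hankel a c b w z0 z1 z2 f0 f1 f2 :
  coframe a c b w 0 L (mx3 [:: [:: z0; z1; z2]; [::]; [::]]) ->
  z0 * f0 + z1 * f1 + z2 * f2 = 0 ->
  let f3 := l0 * f0 + l1 * f1 + l2 * f2 in
  let f4 := l0 * f1 + l1 * f2 + l2 * f3 in
  f0 * (f2 * f4 - f3 ^+ 2) - f1 * (f1 * f4 - f2 * f3)
    + f2 * (f1 * f3 - f2 ^+ 2) != 0 ->
  symplectic g.
Proof.
move=> cof fz f3 f4 detS.
apply: (coframe_symplectic_sym
  (S := mx3 [:: [:: f0; f1; f2]; [:: f1; f2; f3]; [:: f2; f3; f4]]) dim_g cof).
- by mx3_ring.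
- by rewrite /f4 /f3; mx3_ring.
- by rewrite -fz /mxtrace; mx3_unfold; ring.
- by apply: (det3_neq0 _ detS); rewrite det_mx33; mx3_unfold; ring.
Qed.

End Companion.

(** The exceptional case: [v_1, v_2] is z q with q = T^2 + q1 T + q0, where
    (T - mu) q is the characteristic polynomial, so that T q = mu q.  Every form
    f with f (q) = 0 vanishes on the ideal of q, and its Hankel matrix is
    singular.  The pairing below takes t with t (z q) = 1. *)
Lemma coframe_cyclic_eigen a c b w q0 q1 mu z :
  coframe a c b w 0
    (mx3 [:: [:: 0; 1; 0]; [:: 0; 0; 1]; [:: mu * q0; mu * q1 - q0; mu - q1]])
    (mx3 [:: [:: z * q0; z * q1; z]; [::]; [::]]) ->
  z != 0 -> symplectic g.
Proof.
move=> cof z0.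
apply: (coframe_symplectic (S := mx3 [:: [::]; [::]; [:: 0; 1; - q1]])
    (t := cv3 [:: 0; 1; z^-1 - q1]) dim_g cof).
+ by apply/colP; apply: forall_ord3; mx3_unfold; field.
+ by apply/colP; apply: forall_ord3; mx3_unfold; field.
+ by rewrite /mxtrace; mx3_unfold; ring.
move=> v /rowP vS /rowP vt /rowP vLt.
move: (vS o1) (vt 0) (vLt 0); mx3_unfold.
rewrite !(mulr0, mulr1, add0r, addr0, mul0r, mul1r) => v2.
rewrite v2 !mul0r !addr0 => v1; rewrite v1 mul0r addr0 => v0.
by apply/rowP; apply: forall_ord3; rewrite mxE.
Qed.

(** If z has degree less than 2, the form f = (0, 0, 1) on (1, T, T^2) works.
    Otherwise z is a multiple of a monic q of degree 2, and division of the
    characteristic polynomial gives (T - mu) q + r1 T + constant, with value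
    rho at mu.  The remainder vanishes exactly in the exceptional case.  If it
    does not, one of three forms f has an invertible Hankel matrix: those with
    (f (1), f (T)) = (0, 1), (1, mu), (1, mu + 1), and f (T^2) fixed by
    f (q) = 0.  Their determinants are rho, then - r1 q(mu)^2 if rho = 0, then
    - r1^2 if moreover q(mu) = 0. *)
Lemma symplectic_cyclic a c b w l0 l1 l2 P :
  coframe a c b w 0 (mx3 [:: [:: 0; 1; 0]; [:: 0; 0; 1]; [:: l0; l1; l2]]) P ->
  symplectic g.
Proof.
move=> /coframe_cyclic_normal[a' [c' [z0 [z1 [z2]]]]] cof.
have hankel := coframe_cyclic_hankel cof.
have [z2E|z2n0] := eqVneq z2 0.
  apply: (hankel 0 0 1); first by rewrite z2E; ring.
  by rewrite (_ : _ + _ = -1) ?neq0N1//; ring.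
pose q0 := z0 / z2; pose q1 := z1 / z2.
have z0E : z0 = z2 * q0 by rewrite /q0; field.
have z1E : z1 = z2 * q1 by rewrite /q1; field.
pose mu := l2 + q1; pose r1 := mu * q1 - q0 - l1.
pose rho := r1 * mu + (mu * q0 - l0); pose Q := mu ^+ 2 + q1 * mu + q0.
have l2E : l2 = mu - q1 by rewrite /mu; ring.
have l1E : l1 = mu * q1 - q0 - r1 by rewrite /r1; ring.
have l0E : l0 = r1 * mu + mu * q0 - rho by rewrite /rho; ring.
have [rho0|rho0] := eqVneq rho 0; last first.
  apply: (hankel 0 1 (- q1)); first by rewrite z1E; ring.
  by rewrite (_ : _ + _ = rho) // l2E l1E l0E; ring.
have [r10|r1n0] := eqVneq r1 0.
  apply: (coframe_cyclic_eigen (q0 := q0) (q1 := q1) (mu := mu) _ z2n0).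
  move: cof; rewrite z0E z1E l2E l1E l0E r10 rho0 mul0r add0r !subr0; exact.
have [Q0|Qn0] := eqVneq Q 0; last first.
  apply: (hankel 1 mu (- (q1 * mu + q0))); first by rewrite z0E z1E; ring.
  rewrite (_ : _ + _ = - r1 * Q ^+ 2).
    by rewrite mulf_neq0 ?oppr_eq0 ?expf_neq0.
  by rewrite /Q l2E l1E l0E rho0; ring.
have q0E : q0 = - (mu ^+ 2 + q1 * mu).
  by apply/eqP; rewrite -addr_eq0 addrC -/Q Q0.
apply: (hankel 1 (mu + 1) (- (q1 * (mu + 1) + q0))).
  by rewrite z0E z1E; ring.
rewrite (_ : _ + _ = - r1 ^+ 2); first by rewrite oppr_eq0 expf_neq0.
by rewrite l2E l1E l0E rho0 q0E; ring.
Qed.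

End CyclicCase.

(** * Derived algebra of dimension four *)

Section FourDimensionalDerived.
Context {K : fieldType} {g : lieAlgType K}.
Hypothesis dim_g : \dim {:g} = 8%N.

(** Here c is the coordinate on the fourth basis vector w_3 of the derived
    algebra.  Take B (w_3, X) = - 1 and B (w_k, X) = 0 otherwise.  Closedness on
    (X, v_i, v_j) then prescribes the skew-symmetric part of S, which a
    unitriangular S realizes.  Closedness on (v_0, v_1, v_2) is one equation on
    the values s of B (w_3, _) on the v_j, and it is solvable because E <> 0. *)
Lemma symplectic_coframe4 a c (b w : 'I_3 -> g -> K) E P :
  coframe a c b w E 0 P -> E != 0 -> symplectic g.
Proof.
case=> a_lin c_lin b_lin w_lin inj a_br b_br c_br w_br E0.
pose S := mx3
  [:: [:: 1; E 0 o2; - E 0 o1]; [:: 0; 1; E 0 o0]; [:: 0; 0; 1]].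
have [s sE] : exists s : 'I_3 -> K, \sum_i E 0 i * s i = - \tr (P *m S).
  have /rV0Pn[i Ei] := E0.
  exists (fun j => if j == i then - \tr (P *m S) / E 0 i else 0).
  rewrite (bigD1 i)//= eqxx big1 ?addr0 => [|j /negPf->]; last exact: mulr0.
  by rewrite mulrC divfK.
pose p (i : 'I_(3 + 1)) x := col_mx (S *m \col_i b i x)
  (\col_(_ < 1) (\sum_i s i * b i x - a x)) i 0.
pose q (i : 'I_(3 + 1)) x := col_mx (\col_i w i x) (\col_(_ < 1) c x) i 0.
have pl i x : p (lshift 1 i) x = \sum_j S i j * b j x.
  by rewrite /p col_mxEu mxE; apply: eq_bigr => j _; rewrite [X in _ * X]mxE.
have pr i x : p (rshift 3 i) x = \sum_i s i * b i x - a x.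
  by rewrite /p col_mxEd mxE.
have ql i x : q (lshift 1 i) x = w i x by rewrite /q col_mxEu mxE.
have qr i x : q (rshift 3 i) x = c x by rewrite /q col_mxEd mxE.
apply: (@symplectic_darboux K g (3 + 1) p q) => //.
- move=> i k x y; rewrite -(splitK i); case: (split i) => j.
    by rewrite !pl !sum_ord3 !b_lin; ring.
  by rewrite !pr a_lin !sum_ord3 !b_lin; ring.
- move=> i k x y; rewrite -(splitK i); case: (split i) => j.
    by rewrite !ql w_lin.
  by rewrite !qr c_lin.
- move=> x px qx.
  have := px (lshift 1 o2); rewrite pl; mx3_unfold.
  rewrite !mul0r !add0r mul1r => b2.
  have := px (lshift 1 o1); rewrite pl; mx3_unfold.
  rewrite b2 mulr0 mul0r add0r addr0 mul1r => b1.
  have := px (lshift 1 o0); rewrite pl; mx3_unfold.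
  rewrite b1 b2 !mulr0 !addr0 mul1r => b0.
  have bx : forall i, b i x = 0 by apply: forall_ord3.
  apply: inj => // [||i]; last by rewrite -(ql i x).
    have := px (rshift 3 0); rewrite pr big1 => [|i _]; last first.
      by rewrite bx mulr0.
    by rewrite sub0r => /eqP; rewrite oppr_eq0 => /eqP.
  by rewrite -(qr 0 x).
move=> x y z.
have th u v t : \sum_i wedge (p i) (q i) [lie u, v] t
    = - (\sum_(k < 3) (\sum_j S k j * b j t) * w k [lie u, v]
       + (\sum_i s i * b i t - a t) * c [lie u, v]).
  rewrite big_split_ord big_ord1 opprD -sumrN /=; congr (_ + _).
    apply: eq_bigr => k _; rewrite /wedge !pl !ql [X in X * _]big1 => [|j _].
      by rewrite mul0r sub0r.
    by rewrite b_br mulr0.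
  rewrite /wedge !pr !qr a_br big1 => [|j _]; last by rewrite b_br mulr0.
  by rewrite subrr mul0r sub0r.
pose D (f1 f2 f3 : g -> K) := f1 x * wedge f2 f3 y z + f1 y * wedge f2 f3 z x
  + f1 z * wedge f2 f3 x y.
transitivity (- (D (b o0) (b o1) (b o2) * (\sum_i E 0 i * s i + \tr (P *m S)))).
  rewrite /d2 !th !sum_ord3 !w_br !c_br /D /mxtrace /wedge_row /wedge.
  by mx3_unfold; ring.
by rewrite sE addNr mulr0 oppr0.
Qed.

End FourDimensionalDerived.

(** * The excluded algebra *)

Lemma lie_skew (K : fieldType) (g : lieAlgType K) (x y : g) :
  [lie x, y] = - [lie y, x].
Proof.
apply/eqP; rewrite -addr_eq0; have := lie_bracketxx (x + y).
by rewrite linearDl !linearDr /= !lie_bracketxx add0r addr0 => ->.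
Qed.

Section MC8.
Context {K : fieldType} {g h : lieAlgType K}.
Variable e : 8.-tuple h.
Hypotheses (e_basis : basis_of {:h} e) (e_mc : maurer_cartan8 e).

Let alpha (k : nat) : h -> K := coord e (inord k.-1).

Lemma mc8_bracketE x y : [lie x, y] =
  wedge (alpha 1) (alpha 2) x y *: e`_2 + wedge (alpha 1) (alpha 4) x y *: e`_4
  + (wedge (alpha 1) (alpha 6) x y + wedge (alpha 2) (alpha 4) x y
     + wedge (alpha 6) (alpha 8) x y) *: e`_6.
Proof.
have [/oppr_inj a3 /oppr_inj a5 E7 E0] := e_mc x y.
have a7 : alpha 7 [lie x, y] = wedge (alpha 1) (alpha 6) x y
    + wedge (alpha 2) (alpha 4) x y + wedge (alpha 6) (alpha 8) x y.
  by apply: oppr_inj; rewrite [LHS]E7 !opprD.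
have a0 k : k \in [:: 1; 2; 4; 6; 8]%N -> alpha k [lie x, y] = 0.
  by move=> /E0 E; apply: oppr_inj; rewrite oppr0.
rewrite [LHS](coord_basis e_basis (memvf _)).
transitivity (\sum_(i < 8) alpha i.+1 [lie x, y] *: e`_i).
  by apply: eq_bigr => i _; rewrite /alpha /= inord_val.
rewrite -(big_mkord xpredT (fun i => alpha i.+1 [lie x, y] *: e`_i)).
rewrite unlock /=.
rewrite (a0 1%N)// (a0 2%N)// (a0 4%N)// (a0 6%N)// (a0 8%N)//.
by rewrite !scale0r !add0r !addr0 addrA a7 [alpha 3 _]a3 [alpha 5 _]a5.
Qed.

Lemma mc8_alpha k l : (0 < k <= 8)%N -> (0 < l <= 8)%N ->
  alpha k e`_l.-1 = (l == k)%:R.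
Proof.
case: k l => [//|k] [//|l] /= lek lel; rewrite /alpha /=.
rewrite -[l in nth _ _ l](@inordK 7) // coord_free ?(basis_free e_basis)//.
by congr (_%:R); rewrite -val_eqE /= !inordK // eqSS eq_sym.
Qed.

(** Closedness on triples of basis vectors gives theta (e_7, e_i) = 0 for all i:
    e_7 = [e_6, e_8] = [e_2, e_4] = [e_1, e_6], and in each triple used below
    the other two brackets vanish or contribute a value already known to be
    zero.  For i = 3, 5, 7 it follows from the isotropy of the derived
    algebra. *)
Lemma mc8_not_symplectic :
  (forall x y z : g, [lie x, [lie y, z]] = 0) -> lie_isomorphic g h ->
  ~ symplectic g.
Proof.
move=> nil [f [fI fK fIK] f_br] [theta [closed nondeg]].
pose E k := fI e`_(k.-1).
have fI0 : fI 0 = 0 by apply: (can_inj fK); rewrite fIK linear0.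
have br k l x : [lie e`_(k.-1), e`_(l.-1)] = x -> [lie E k, E l] = fI x.
  by move=> <-; apply: (can_inj fK); rewrite f_br !fIK.
have simp := (mulr0n, mulr1n, mulr0, mul0r,
  mulr1, subr0, sub0r, oppr0, add0r, addr0, scale0r, scale1r, scaleN1r).
have E12 : [lie E 1, E 2] = E 3.
  by apply: br; rewrite mc8_bracketE /wedge !mc8_alpha //= !simp.
have E14 : [lie E 1, E 4] = E 5.
  by apply: br; rewrite mc8_bracketE /wedge !mc8_alpha //= !simp.
have E16 : [lie E 1, E 6] = E 7.
  by apply: br; rewrite mc8_bracketE /wedge !mc8_alpha //= !simp.
have E24 : [lie E 2, E 4] = E 7.
  by apply: br; rewrite mc8_bracketE /wedge !mc8_alpha //= !simp.
have E68 : [lie E 6, E 8] = E 7.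
  by apply: br; rewrite mc8_bracketE /wedge !mc8_alpha //= !simp.
have br0 k l : [lie e`_(k.-1), e`_(l.-1)] = 0 -> [lie E k, E l] = 0.
  by move/br->.
have E82 : [lie E 8, E 2] = 0.
  by apply: br0; rewrite mc8_bracketE /wedge !mc8_alpha //= !simp.
have E26 : [lie E 2, E 6] = 0.
  by apply: br0; rewrite mc8_bracketE /wedge !mc8_alpha //= !simp.
have E84 : [lie E 8, E 4] = 0.
  by apply: br0; rewrite mc8_bracketE /wedge !mc8_alpha //= !simp.
have E46 : [lie E 4, E 6] = 0.
  by apply: br0; rewrite mc8_bracketE /wedge !mc8_alpha //= !simp.
have E62 : [lie E 6, E 2] = 0.
  by apply: br0; rewrite mc8_bracketE /wedge !mc8_alpha //= !simp.
have E48 : [lie E 4, E 8] = 0.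
  by apply: br0; rewrite mc8_bracketE /wedge !mc8_alpha //= !simp.
have E81 : [lie E 8, E 1] = 0.
  by apply: br0; rewrite mc8_bracketE /wedge !mc8_alpha //= !simp.
have nil' (x y z : g) : [lie [lie x, y], z] = 0.
  by rewrite (lie_skew _ z) nil oppr0.
have t0 y : theta 0 y = 0 by exact: linear0l.
have tW (x y u v : g) : theta [lie x, y] [lie u, v] = 0.
  by have := closed x y [lie u, v]; rewrite /d2 nil nil' !t0 !addr0.
have t72 : theta (E 7) (E 2) = 0.
  by have := closed (E 6) (E 8) (E 2); rewrite /d2 E68 E82 E26 !t0 !addr0.
have t74 : theta (E 7) (E 4) = 0.
  by have := closed (E 6) (E 8) (E 4); rewrite /d2 E68 E84 E46 !t0 !addr0.
have t76 : theta (E 7) (E 6) = 0.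
  by have := closed (E 2) (E 4) (E 6); rewrite /d2 E24 E46 E62 !t0 !addr0.
have t78 : theta (E 7) (E 8) = 0.
  by have := closed (E 2) (E 4) (E 8); rewrite /d2 E24 E48 E82 !t0 !addr0.
have t71 : theta (E 7) (E 1) = 0.
  have := closed (E 1) (E 6) (E 8).
  by rewrite /d2 E16 E68 E81 t78 t0 add0r addr0.
have t73 : theta (E 7) (E 3) = 0 by rewrite -E68 -E12 tW.
have t75 : theta (E 7) (E 5) = 0 by rewrite -E68 -E14 tW.
have t77 : theta (E 7) (E 7) = 0 by rewrite -E68 tW.
have tE (i : 'I_8) : theta (E 7) (E i.+1) = 0.
  by case: i => [[|[|[|[|[|[|[|[|//]]]]]]]] ?].
have t7 y : theta (E 7) y = 0.
  have -> : y = \sum_(i < 8) coord e i (f y) *: E i.+1.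
    apply: (can_inj fK); rewrite linear_sum.
    rewrite [LHS](coord_basis e_basis (memvf _)).
    by apply: eq_bigr => i _; rewrite linearZ /= fIK.
  by rewrite linear_sumr big1// => i _; rewrite linearZr_LR /= tE mulr0.
have : E 7 \in orthov theta fullv by apply/mem_orthovP => y _; exact: t7.
rewrite (eqP nondeg) memv0 => /eqP E70.
have := @mc8_alpha 7 7 isT isT; rewrite -(fIK e`_7.-1) -/(E 7) E70 linear0
  [alpha 7 0]linear0.
by move/esym/eqP; rewrite eqxx oner_eq0.
Qed.
(** The forms a, b_0, w_0, p b_1, p w_1, b_2, w_2, - k c satisfy the structure
    equations of h, so they are the coordinates of an isomorphism. *)
Lemma mc8_isomorphic (a c : g -> K) b w k p :
  \dim {:g} = 8%N -> k != 0 -> p != 0 ->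
  coframe a c b w 0 (mx3 [:: [::]; [::]; [:: 0; 0; k]])
    (mx3 [:: [::]; [::]; [:: 0; 0; p]]) ->
  lie_isomorphic g h.
Proof.
move=> dim_g k0 p0 [a_lin c_lin b_lin w_lin inj a_br b_br c_br w_br].
pose xi (i : nat) x : K := nth 0 [:: a x; b o0 x; w o0 x; p * b o1 x;
  p * w o1 x; b o2 x; w o2 x; - k * c x] i.
pose F x : h := \sum_(i < 8) xi i x *: e`_i.
have F_lin : linear F.
  move=> r x y; rewrite /F scaler_sumr -big_split /=; apply: eq_bigr => i _.
  rewrite scalerA -scalerDl; congr (_ *: _).
  by case: i => [[|[|[|[|[|[|[|[|//]]]]]]]] ?]; rewrite /xi /=
    ?a_lin ?b_lin ?c_lin ?w_lin //; ring.
pose FL := GRing.isLinear.Build K g h _ F F_lin.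
pose Fl : {linear g -> h} := HB.pack F FL.
have FlE x : linfun Fl x = F x by rewrite lfunE.
have coordF (i : 'I_8) x : coord e i (F x) = xi i x.
  by rewrite /F coord_sum_free ?(basis_free e_basis).
have alphaF n x : (0 < n <= 8)%N -> alpha n (F x) = xi n.-1 x.
  by case: n => // n n8; rewrite /alpha coordF inordK.
have F_inj : injective F.
  suff F0 x : F x = 0 -> x = 0.
    move=> x y Fxy; apply/eqP; rewrite -subr_eq0; apply/eqP/F0.
    by rewrite addrC -scaleN1r F_lin Fxy scaleN1r addNr.
  move=> Fx0; have xi0 (i : 'I_8) : xi i x = 0 by rewrite -coordF Fx0 linear0.
  have nz r s : r != 0 -> r * s = 0 -> s = 0 :> K.
    by move=> r0 /eqP; rewrite mulf_eq0 (negPf r0) => /eqP.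
  apply: inj.
  - exact: (xi0 (@Ordinal 8 0 isT)).
  - by apply: (nz (- k)); rewrite ?oppr_eq0//; exact: (xi0 (@Ordinal 8 7 isT)).
  - apply: forall_ord3.
    + exact: (xi0 (@Ordinal 8 1 isT)).
    + by apply: (nz p) => //; exact: (xi0 (@Ordinal 8 3 isT)).
    + exact: (xi0 (@Ordinal 8 5 isT)).
  - apply: forall_ord3.
    + exact: (xi0 (@Ordinal 8 2 isT)).
    + by apply: (nz p) => //; exact: (xi0 (@Ordinal 8 4 isT)).
    + exact: (xi0 (@Ordinal 8 6 isT)).
have kerF : lker (linfun Fl) == 0%VS.
  by apply/lker0P => x y; rewrite !FlE; exact: F_inj.
have imF : limg (linfun Fl) = fullv.
  apply/eqP; rewrite eqEdim subvf /= limg_dim_eq ?(eqP kerF) ?capv0//.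
  by rewrite dim_g (size_basis e_basis).
exists (linfun Fl).
  exists (linfun Fl)^-1%VF => x; first exact: lker0_lfunK.
  by apply: limg_lfunVK; rewrite imF memvf.
move=> x y; rewrite !FlE mc8_bracketE /wedge !alphaF //.
rewrite /F -(big_mkord xpredT (fun i => xi i [lie x, y] *: e`_i)) unlock /=.
rewrite /xi /= a_br c_br !b_br !w_br /wedge_row /wedge.
mx3_unfold.
rewrite !(mulr0, mul0r, scale0r, add0r, addr0) addrA.
by congr (_ *: _ + _ *: _ + _ *: _); ring.
Qed.
End MC8.

(** * Rank of an operator of given Jordan type *)

Section Rank.
Context {K : fieldType} {V : vectType K}.
Import passmx.

Lemma rank_limg (f : 'End(V)) n (e : n.-tuple V) (M : 'M_n) :
  basis_of {:V} e -> (forall i : 'I_n, f e`_i = \sum_j M i j *: e`_j) ->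
  \dim (limg f) = \rank M.
Proof.
move=> e_basis; have dimV := size_basis e_basis; move: e M e_basis.
rewrite -{n}dimV => e M e_basis fe.
have e_free := basis_free e_basis; set n := \dim _ in e M e_basis fe e_free *.
pose X := [tuple vecof e (row i (row_base M)) | i < \rank M].
have vecof_lin (m : nat) (v : 'rV_m) (R : 'M_(m, n)) :
    \sum_i v 0 i *: vecof e (row i R) = vecof e (v *m R).
  rewrite mulmx_sum_row linear_sum; apply: eq_bigr => i _.
  by rewrite linearZ.
have fE v : f (vecof e v) = vecof e (v *m M).
  rewrite -vecof_lin /vecof linear_sum; apply: eq_bigr => i _.
  by rewrite linearZ /= fe; congr (_ *: _); apply: eq_bigr => j _; rewrite mxE.
have XE (k : 'I_(\rank M) -> K) :
    \sum_i k i *: X`_i = vecof e ((\row_i k i) *m row_base M).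
  rewrite -vecof_lin; apply: eq_bigr => i _.
  by rewrite -tnth_nth tnth_mktuple mxE.
have X_free : free X.
  apply/freeP => k; rewrite XE => /eqP; rewrite vecof_eq0// => /eqP k0 i.
  have /rowP/(_ i) : \row_i k i = 0.
    by apply: (row_free_inj (row_base_free M)); rewrite k0 mul0mx.
  by rewrite !mxE.
suff -> : limg f = <<X>>%VS by rewrite (eqnP X_free) size_tuple.
apply/vspaceP => v; apply/idP/idP.
  move=> /memv_imgP[u _ ->]; rewrite -(rVofK e_basis u) fE.
  have /submxP[D ->] : (rVof e u *m M <= row_base M)%MS.
    by rewrite eq_row_base submxMl.
  rewrite -vecof_lin memv_suml// => i _; rewrite memvZ// memv_span//.
  by apply/tnthP; exists i; rewrite tnth_mktuple.
move: v; apply/subvP/span_subvP => _ /tnthP[i ->]; rewrite tnth_mktuple.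
have /submxP[D ->] : (row i (row_base M) <= M)%MS.
  by rewrite -(eq_row_base M) row_sub.
by rewrite -fE memv_img ?memvf.
Qed.

Lemma rank_jordan_22211 (f : 'End(V)) :
  jordan_type f [:: 2; 2; 2; 1; 1]%N -> \dim (limg f) = 3%N.
Proof.
case=> _ _ [e e_basis fe]; rewrite (rank_limg e_basis fe) rank_mxdiag.
have rk2 : \rank (jordan_block K 2) = 1%N.
  apply/eqP; rewrite eqn_leq; apply/andP; split; last first.
    rewrite lt0n mxrank_eq0; apply/negP => /eqP/matrixP/(_ 0 1).
    by rewrite !mxE /= => /eqP; rewrite oner_eq0.
  rewrite -ltnS ltnNge; apply/negP => rk2.
  have : row_free (jordan_block K 2) by rewrite /row_free eqn_leq rank_leq_row.
  rewrite row_free_unit => /mulVmx/matrixP/(_ 0 0).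
  rewrite !mxE big1 => [/eqP|j _]; first by rewrite eq_sym oner_eq0.
  by rewrite mxE mulr0.
have rk1 : \rank (jordan_block K 1) = 0%N.
  apply/eqP; rewrite mxrank_eq0; apply/eqP/matrixP => i j.
  by rewrite !mxE !ord1.
by do 5! rewrite big_ord_recl /=; rewrite big_ord0 rk2 rk1.
Qed.
End Rank.

(** * Endomorphisms of a three-dimensional space, up to scalars *)

Section NormalForm.
Context {K : fieldType} {V : vectType K}.
Implicit Types (W : {vspace V}) (T N : 'End(V)).

Lemma mem_span3P (x a b c : V) :
  reflect (exists k : K * K * K, x = k.1.1 *: a + k.1.2 *: b + k.2 *: c)
    (x \in <<[:: a; b; c]>>%VS).
Proof.
rewrite 2!span_cons span_seq1 addvA; apply: (iffP memv_addP).
  case=> _ /memv_addP[_ /vlineP[k ->] [_ /vlineP[l ->] ->]].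
  case=> _ /vlineP[m ->] ->.
  by exists (k, l, m).
case=> [[[k l] m] /= ->]; exists (k *: a + l *: b).
  by rewrite memv_add// memvZ// memv_line.
by exists (m *: c); rewrite ?memvZ ?memv_line.
Qed.

Lemma basis3_change W (a b c a' b' c' : V) : basis_of W [:: a; b; c] ->
  a \in <<[:: a'; b'; c']>>%VS -> b \in <<[:: a'; b'; c']>>%VS ->
  c \in <<[:: a'; b'; c']>>%VS -> basis_of W [:: a'; b'; c'].
Proof.
move=> bW a_in b_in c_in; have dimW := size_basis (X := [tuple a; b; c]) bW.
have sW : (W <= <<[:: a'; b'; c']>>)%VS.
  rewrite -(span_basis bW); apply/span_subvP => x.
  by rewrite !inE => /or3P[]/eqP->.
by rewrite basisEdim sW dimW.
Qed.

Lemma basis3_extend W (a b c : V) : \dim W = 3%N -> free [:: a; b] ->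
  a \in W -> b \in W -> c \in W -> c \notin <<[:: a; b]>>%VS ->
  basis_of W [:: a; b; c].
Proof.
move=> dimW fab Wa Wb Wc cab.
have fX : free [:: a; b; c].
  have abc : perm_eq [:: a; b; c] [:: c; a; b].
    by apply/permPl; exact: (perm_catC [:: a; b] [:: c]).
  by rewrite (perm_free abc) free_cons cab.
rewrite basisEfree fX dimW !andbT; apply/span_subvP => x.
by rewrite !inE => /or3P[]/eqP->.
Qed.

Lemma basis3_exists W : \dim W = 3%N ->
  exists w0 w1 w2, basis_of W [:: w0; w1; w2].
Proof.
move=> dimW; have := vbasisP W; case: (vbasis W) => s /= /eqP; rewrite dimW.
by case: s => [|w0 [|w1 [|w2 [|//]]]]//; exists w0, w1, w2.
Qed.

Lemma dim_add_line (x : V) (U : {vspace V}) : x \notin U ->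
  \dim (<[x]> + U) = (\dim U).+1.
Proof.
move=> xU; rewrite dimv_disjoint_sum; last first.
  apply/eqP; rewrite -subv0; apply/subvP => y; rewrite memv_cap.
  case/andP => /vlineP[k ->] kxU; have [->|k0] := eqVneq k 0.
    by rewrite scale0r mem0v.
  by case/negP: xU; rewrite -(scalerK k0 x) memvZ.
by rewrite dim_vline (_ : x != 0) //; apply: contraNneq xU => ->; rewrite mem0v.
Qed.

Lemma free2 (a b : V) : b \notin <[a]>%VS -> a != 0 -> free [:: a; b].
Proof.
move=> ba a0; have ab : perm_eq [:: a; b] [:: b; a].
  by apply/permPl; exact: (perm_catC [:: a] [:: b]).
by rewrite (perm_free ab) free_cons span_seq1 ba seq1_free.
Qed.

(** The four shapes reached by T - d, for a suitable scalar d.  No eigenvalue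
    has to be chosen in the cyclic case, so that the field is arbitrary. *)
Variant normal3 W N : Prop :=
| Normal3Zero w0 w1 w2 of basis_of W [:: w0; w1; w2] &
    N w0 = 0 & N w1 = 0 & N w2 = 0
| Normal3Semisimple w0 w1 w2 k of basis_of W [:: w0; w1; w2] & k != 0 &
    N w0 = 0 & N w1 = 0 & N w2 = k *: w2
| Normal3Nilpotent w0 w1 w2 of basis_of W [:: w0; w1; w2] &
    N w0 = w1 & N w1 = 0 & N w2 = 0
| Normal3Cyclic w0 w1 w2 of basis_of W [:: w0; w1; w2] &
    N w0 = w1 & N w1 = w2.

(** If T is not scalar, some w is not an eigenvector.  If w, T w, T^2 w are
    dependent, they span a T-stable plane; let d be the eigenvalue of T on the
    quotient by this plane, and N = T - d.  In a basis w, x = N w, y with y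
    outside the plane, N y is a multiple of w and N x = l w + k x.  If N y <> 0,
    then y is cyclic for N; if N y = 0 and l <> 0, then w + y is cyclic;
    otherwise N has rank one and its trace k decides between the two shapes. *)
Lemma normal3P W T : \dim W = 3%N -> (forall x, x \in W -> T x \in W) ->
  exists d : K, normal3 W (T - d *: \1%VF).
Proof.
move=> dimW TW.
have NE d x : (T - d *: \1%VF) x = T x - d *: x by rewrite !lfun_simp.
have [w0 [w1 [w2 bW]]] := basis3_exists dimW.
have [w0W w1W w2W] : [/\ w0 \in W, w1 \in W & w2 \in W].
  by split; apply: (basis_mem bW); rewrite !inE eqxx ?orbT.
have := basis_free bW; rewrite free_cons => /andP[w0_notin _].
have [w01 w02] : w0 \notin <[w1]>%VS /\ w0 \notin <[w2]>%VS.
  by split; apply: contra w0_notin; apply: subvP;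
    rewrite -memvE memv_span// !inE eqxx ?orbT.
have [w1n0 w2n0] : w1 != 0 /\ w2 != 0.
  by split; apply: (basis_not0 bW); rewrite !inE eqxx ?orbT.
(* If these five vectors are eigenvectors, their eigenvalues coincide. *)
pose test := [:: w0; w1; w2; w0 + w1; w0 + w2].
have [/allP tests|/allPn[w w_test]] :=
  boolP (all (fun w => T w \in <[w]>%VS) test).
  have [d0 T0] : exists d, T w0 = d *: w0.
    by apply/vlineP/tests; rewrite !inE eqxx.
  have scal x : x != 0 -> w0 \notin <[x]>%VS -> x \in test -> w0 + x \in test ->
      T x = d0 *: x.
    move=> x0 xw0 x_test wx_test; have /vlineP[d1 Tx] := tests _ x_test.
    have /vlineP[d Twx] := tests _ wx_test.
    have E : (d - d1) *: x = (d0 - d) *: w0.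
      rewrite !scalerBl -T0 -Tx; apply/eqP; rewrite subr_eq addrAC eq_sym.
      by rewrite subr_eq -linearD /= Twx scalerDr addrC.
    have [dd0|dd0] := eqVneq d0 d; last first.
      case/negP: xw0; apply/vlineP; exists ((d0 - d)^-1 * (d - d1)).
      by rewrite -scalerA E scalerA mulVf ?scale1r// subr_eq0.
    move: E; rewrite dd0 subrr scale0r => /eqP.
    by rewrite scaler_eq0 (negPf x0) orbF subr_eq0 => /eqP ->.
  have [Tw1 Tw2] : T w1 = d0 *: w1 /\ T w2 = d0 *: w2.
    by split; apply: scal; rewrite ?inE ?eqxx ?orbT.
  by exists d0; apply: (Normal3Zero bW); rewrite NE ?T0 ?Tw1 ?Tw2 subrr.
have Ww : w \in W.
  move: w_test; rewrite !inE => /or4P[| | |/orP[]]/eqP->; rewrite ?memvD//.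
move=> Tww; have wn0 : w != 0.
  by apply: contraNneq Tww => ->; rewrite linear0 mem0v.
have free_wTw := free2 Tww wn0.
have [TTw|TTw] := boolP (T (T w) \in <<[:: w; T w]>>%VS); last first.
  exists 0; apply: (@Normal3Cyclic _ _ w (T w) (T (T w)));
    rewrite ?NE ?scale0r ?subr0//.
  by apply: basis3_extend; rewrite ?TW.
have [v Wv vU] : exists2 v, v \in W & v \notin <<[:: w; T w]>>%VS.
  apply/subvPn; apply/negP => /dimvS.
  by rewrite dimW (eqnP free_wTw).
have bwTv : basis_of W [:: w; T w; v] by apply: basis3_extend; rewrite ?TW.
have /mem_span3P[[[p q] d] /= Tv] : T v \in <<[:: w; T w; v]>>%VS.
  by rewrite (span_basis bwTv) TW.
move: TTw; rewrite span_cons span_seq1.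
move=> /memv_addP[_ /vlineP[r ->] [_ /vlineP[s ->] TTw]].
exists d; set N := T - _.
pose x := N w; pose y := v - q *: w.
have TwE : T w = x + d *: w by rewrite /x NE subrK.
have Ny : N y = (p + q * d) *: w.
  rewrite linearB linearZ /= !NE Tv addrK scalerBr scalerA scalerDl opprB.
  by rewrite addrC [p *: w + _]addrC subrKA addrC.
have Nx : N x = (r + (s - d) * d) *: w + (s - d - d) *: x.
  have Tx : T x = r *: w + (s - d) *: T w.
    by rewrite /x NE linearB linearZ /= TTw -addrA -scalerBl.
  rewrite NE Tx TwE scalerDr scalerA [_ *: x + _]addrC addrA -scalerDl.
  by rewrite -addrA -scalerBl.
have bwxy : basis_of W [:: w; x; y].
  apply: (basis3_change bwTv); apply/mem_span3P.
  - by exists (1, 0, 0); rewrite /= scale1r !scale0r !addr0.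
  - by exists (d, 1, 0); rewrite /= scale1r !scale0r !addr0 TwE addrC.
  - by exists (q, 0, 1); rewrite /= scale1r !scale0r !addr0 addrC subrK.
have [k0|k0] := eqVneq (p + q * d) 0; last first.
  apply: (@Normal3Cyclic _ _ y (N y) (N (N y))) => //.
  rewrite Ny linearZ /= -/x.
  apply: (basis3_change bwxy); apply/mem_span3P.
  - exists (0, (p + q * d)^-1, 0); rewrite /= !scale0r add0r addr0.
    by rewrite scalerA mulVf ?scale1r.
  - exists (0, 0, (p + q * d)^-1); rewrite /= !scale0r !add0r.
    by rewrite scalerA mulVf ?scale1r.
  - by exists (1, 0, 0); rewrite /= scale1r !scale0r !addr0.
move: Ny; rewrite k0 scale0r => Ny.
have [l0|l0] := eqVneq (r + (s - d) * d) 0; last first.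
  apply: (@Normal3Cyclic _ _ (w + y) x (N x)) => //.
    rewrite Nx; apply: (basis3_change bwxy); apply/mem_span3P.
    + exists (0, - (s - d - d) / (r + (s - d) * d), (r + (s - d) * d)^-1).
      rewrite /= scale0r add0r scalerDr !scalerA mulVf// scale1r mulNr.
      by rewrite mulrC scaleNr addrCA addNr addr0.
    + by exists (0, 1, 0); rewrite /= scale1r !scale0r add0r addr0.
    + exists (1, (s - d - d) / (r + (s - d) * d), - (r + (s - d) * d)^-1).
      rewrite /= scale1r scalerDr !scalerA mulNr mulVf// scaleN1r mulNr.
      by rewrite scaleNr [_^-1 * _]mulrC addrA addrAC addrK addrAC subrr add0r.
  by rewrite linearD /= Ny addr0.
move: Nx; rewrite l0 scale0r add0r; set k := s - d - d => Nx.
have [k1|k1] := eqVneq k 0.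
  by apply: (Normal3Nilpotent bwxy); rewrite ?Nx ?k1 ?scale0r.
apply: (@Normal3Semisimple _ _ (w - k^-1 *: x) y x k) => //.
  apply: (basis3_change bwxy); apply/mem_span3P.
  - by exists (1, 0, k^-1); rewrite /= scale1r scale0r addr0 subrK.
  - by exists (0, 0, 1); rewrite /= scale1r !scale0r !add0r.
  - by exists (0, 1, 0); rewrite /= scale1r !scale0r add0r addr0.
by rewrite linearB linearZ /= Nx scalerA mulVf// scale1r subrr.
Qed.
End NormalForm.

(** * From adapted bases to coframes *)

Section Frame.
Context {K : fieldType} {g : lieAlgType K}.
Hypothesis nil : forall x y z : g, [lie x, [lie y, z]] = 0.
Variables (X u : g) (v : 'I_3 -> g) (L : 'M[K]_3).
Let w i := [lie X, v i].
Let e : 8.-tuple g := [tuple X; u; v o0; v o1; v o2; w o0; w o1; w o2].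
Hypothesis e_basis : basis_of {:g} e.
Hypothesis Xu : [lie X, u] = 0.
Hypothesis uv : forall i, [lie u, v i] = \sum_j L i j *: w j.
Hypothesis vv : forall i j, [lie v i, v j] \in <<[:: u; w o0; w o1; w o2]>>%VS.

(** The dual basis of an adapted basis is a coframe.  The u-coordinates of the
    brackets [v_i, v_j] stay explicit, because it is the position of u in
    relation to the derived algebra that decides whether they vanish. *)
Lemma frame_coframe : exists a c b w' (P : 'M_3),
  [/\ c u = 1, forall i, c (w i) = 0 &
   coframe a c b w' (\row_i (if i == o0 then c [lie v o1, v o2] else
     if i == o1 then c [lie v o2, v o0] else c [lie v o0, v o1])) L P].
Proof.
pose xi (n : nat) : g -> K := coord e (inord n).
have xiE m n : (m < 8)%N -> (n < 8)%N -> xi m e`_n = (n == m)%:R.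
  move=> m8 n8; rewrite /xi -[n in nth _ _ n](@inordK 7) //.
  rewrite coord_free ?(basis_free e_basis)//.
  by congr (_%:R); rewrite -val_eqE /= !inordK // eq_sym.
have dec y : y = xi 0 y *: X + xi 1 y *: u + (xi 2 y *: v o0 + xi 3 y *: v o1
    + xi 4 y *: v o2) + (xi 5 y *: w o0 + xi 6 y *: w o1 + xi 7 y *: w o2).
  rewrite {1}[y](coord_basis e_basis (memvf _)).
  transitivity (\sum_(i < 8) xi i y *: e`_i).
    by apply: eq_bigr => i _; rewrite /xi inord_val.
  rewrite -(big_mkord xpredT (fun i => xi i y *: e`_i)) unlock /=.
  by rewrite addr0 !addrA.
have wC y i : [lie w i, y] = 0 by rewrite (lie_skew _ y) nil oppr0.
have Cw y i : [lie y, w i] = 0 by exact: nil.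
have uX : [lie u, X] = 0 by rewrite lie_skew Xu oppr0.
have vX i : [lie v i, X] = - w i by rewrite lie_skew.
have vu i : [lie v i, u] = - [lie u, v i] by rewrite lie_skew.
have vC i j : [lie v i, v j] = - [lie v j, v i] by rewrite lie_skew.
have stripl s t r A y :
    [lie A + (s *: w o0 + t *: w o1 + r *: w o2), y] = [lie A, y].
  by rewrite !linearDl /= !linearZl_LR /= !wC !scaler0 !addr0.
have stripr s t r A y :
    [lie y, A + (s *: w o0 + t *: w o1 + r *: w o2)] = [lie y, A].
  by rewrite !linearDr /= !linearZr_LR /= !Cw !scaler0 !addr0.
(* As the w_i are central, a bracket only depends on five coordinates. *)
have br m y z : xi m [lie y, z] =
    wedge (xi 0) (xi 2) y z * xi m (w o0)
  + wedge (xi 0) (xi 3) y z * xi m (w o1)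
  + wedge (xi 0) (xi 4) y z * xi m (w o2)
  + (wedge (xi 1) (xi 2) y z * xi m [lie u, v o0]
  + wedge (xi 1) (xi 3) y z * xi m [lie u, v o1]
  + wedge (xi 1) (xi 4) y z * xi m [lie u, v o2])
  + (wedge (xi 3) (xi 4) y z * xi m [lie v o1, v o2]
  + wedge (xi 4) (xi 2) y z * xi m [lie v o2, v o0]
  + wedge (xi 2) (xi 3) y z * xi m [lie v o0, v o1]).
  rewrite {1}(dec y) {1}(dec z) stripl stripr /wedge.
  move: (xi 0 y) (xi 1 y) (xi 2 y) (xi 3 y) (xi 4 y) (xi 0 z) (xi 1 z) (xi 2 z)
    (xi 3 z) (xi 4 z).
  rewrite /xi => y0 y1 y2 y3 y4 z0 z1 z2 z3 z4.
  rewrite !linearDl /= !linearDr /= !linearZl_LR /= !linearZr_LR /=.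
  rewrite !lie_bracketxx Xu uX !vX !vu.
  rewrite (vC o1 o0) (vC o2 o1) (vC o0 o2) -!/(w _).
  by rewrite !(linearD, linearZ, linearN, linear0) /=; ring.
have lin m : scalar (xi m) by move=> k x y; rewrite /xi linearP.
have xiD m x y : xi m (x + y) = xi m x + xi m y by rewrite /xi linearD.
have xiZ m k x : xi m (k *: x) = k * xi m x by rewrite /xi linearZ.
have xiu m : (m < 8)%N -> xi m u = (1 == m)%N%:R by move=> m8; exact: (xiE m 1).
have xiw m i : (m < 8)%N -> xi m (w i) = (i + 5 == m)%N%:R.
  move=> m8; move: i; apply: forall_ord3.
  - exact: (xiE m 5).
  - exact: (xiE m 6).
  - exact: (xiE m 7).
have xiuv m i : (m < 8)%N -> xi m [lie u, v i] =
    \sum_(j < 3) L i j * (j + 5 == m)%N%:R.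
  by move=> m8; rewrite uv sum_ord3 !xiD !xiZ !xiw // sum_ord3.
have xivv m i j : m \in [:: 0; 2; 3; 4]%N -> xi m [lie v i, v j] = 0.
  move=> m_in; have := vv i j; rewrite span_cons.
  move=> /memv_addP[_ /vlineP[k ->] [_ /mem_span3P[[[k0 k1] k2] /= ->] ->]].
  have m8 : (m < 8)%N by move: m_in; rewrite !inE => /or4P[]/eqP->.
  rewrite !xiD !xiZ xiu // !xiw //=.
  by move: m_in; rewrite !inE => /or4P[]/eqP-> /=; ring.
exists (xi 0), (xi 1), (fun i => xi (2 + i)%N), (fun i => xi (5 + i)%N).
exists (\matrix_(i, k) xi (5 + k)%N (if i == o0 then [lie v o1, v o2] else
  if i == o1 then [lie v o2, v o0] else [lie v o0, v o1])).
split; first by rewrite xiu.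
  by apply: forall_ord3; rewrite xiw.
split=> //.
- move=> x x0 x1 xb xw; rewrite [LHS]dec x0 x1.
  rewrite (xb o0) (xb o1) (xb o2) (xw o0) (xw o1) (xw o2).
  by rewrite !scale0r !addr0.
- move=> x y; rewrite br !xiuv // !sum_ord3 !xiw // !xivv //=; ring.
- apply: forall_ord3 => x y;
    rewrite br !xiuv // !sum_ord3 !xiw // !xivv //=; ring.
- move=> x y; rewrite br !xiuv // !sum_ord3 !xiw //= /wedge_row !mxE /=; ring.
apply: forall_ord3 => x y;
  rewrite br !xiuv // !sum_ord3 !xiw //= /wedge_row !mxE /=; ring.
Qed.
End Frame.

(** * The two dimensions of the derived algebra *)

Section Frames.
Context {K : fieldType} {g : lieAlgType K}.
Local Notation W := (lower_central g 1).

Lemma adE (x y : g) : ad x y = [lie x, y].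
Proof.
have br_lin : linear (lie_bracket x) by move=> k y1 y2; rewrite linearPr.
pose F : {linear g -> g} := HB.pack (lie_bracket x)
  (GRing.isLinear.Build K g g _ (lie_bracket x) br_lin).
exact: (lfunE F y).
Qed.

Lemma derivedP (x y : g) : [lie x, y] \in W.
Proof.
by have /lie_prodP := subvv W; apply; rewrite memvf.
Qed.

Lemma derived_sub (U : {vspace g}) :
  (forall x y : g, [lie x, y] \in U) -> (W <= U)%VS.
Proof. by move=> brU; apply/lie_prodP => x y _ _. Qed.

Lemma scalar0 (f : g -> K) : scalar f -> f 0 = 0.
Proof.
by move=> /(_ (-1) 0 0); rewrite scaler0 add0r mulN1r addNr.
Qed.

Lemma scalar_comb3 (f : g -> K) k0 k1 k2 x y z : scalar f ->
  f (k0 *: x + k1 *: y + k2 *: z) = k0 * f x + k1 * f y + k2 * f z.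
Proof.
move=> f_lin; rewrite -addrA !f_lin -[k2 *: z]addr0 f_lin scalar0//.
by rewrite addr0 addrA.
Qed.

Definition tri (x y z : g) (i : 'I_3) : g := nth 0 [:: x; y; z] i.

Hypothesis dim_g : \dim {:g} = 8%N.
Hypothesis nil : two_step_nilpotent g.

Lemma central (x y : g) : y \in W -> [lie x, y] = 0.
Proof.
move=> yW; have /lie_prodP := subvv (lower_central g 2).
by rewrite nil.1 => /(_ x y (memvf _) yW); rewrite memv0 => /eqP.
Qed.

Lemma nil3 (x y z : g) : [lie x, [lie y, z]] = 0.
Proof. by apply: central; exact: derivedP. Qed.

Variable X : g.
Hypothesis rankX : \dim (limg (ad X)) = 3%N.
Hypothesis XW : X \notin W.
Local Notation imX := (limg (ad X)).
Local Notation kerX := (lker (ad X)).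

Lemma limg_derived : (imX <= W)%VS.
Proof. by apply/subvP => _ /memv_imgP[y _ ->]; rewrite adE derivedP. Qed.

Lemma derived_lker : (W <= kerX)%VS.
Proof. by apply/subvP => y yW; rewrite memv_ker adE central. Qed.

Lemma dim_lker : \dim kerX = 5%N.
Proof.
have := limg_ker_dim (ad X) fullv; rewrite capfv rankX dim_g.
by move/eqP; rewrite -[8%N]/(5 + 3)%N eqn_add2r => /eqP.
Qed.

Lemma mem_lkerX : X \in kerX.
Proof. by rewrite memv_ker adE lie_bracketxx. Qed.

(** The kernel of ad X has dimension 5 and contains W and X, which is not in W;
    the image of ad X has dimension 3 and is contained in W. *)
Lemma dim_derived : \dim W = 3%N \/ \dim W = 4%N.
Proof.
have dW3 : (3 <= \dim W)%N by rewrite -rankX dimvS// limg_derived.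
have : (\dim (<[X]> + W) <= 5)%N.
  by rewrite -dim_lker dimvS// subv_add derived_lker -memvE mem_lkerX.
rewrite dim_add_line// ltnS => dW4.
by case: (\dim W) dW3 dW4 => [|[|[|[|[|//]]]]]; [| | |left|right].
Qed.

(** Modulo ker (ad X), a vector is determined by its image under ad X. *)
Lemma frame_basis u (v : 'I_3 -> g) :
  let w i := [lie X, v i] in
  basis_of imX [:: w o0; w o1; w o2] ->
  basis_of kerX [:: X; u; w o0; w o1; w o2] ->
  basis_of {:g} [tuple X; u; v o0; v o1; v o2; w o0; w o1; w o2].
Proof.
move=> w bI bC; rewrite basisEdim dim_g andbT.
set S := <<_>>%VS.
have S_in y :
    y \in [:: X; u; v o0; v o1; v o2; w o0; w o1; w o2] -> y \in S.
  exact: memv_span.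
apply/subvP => y _.
have : ad X y \in imX by rewrite memv_img ?memvf.
rewrite -(span_basis bI) => /mem_span3P[[[k0 k1] k2] /= adXy].
pose y' := k0 *: v o0 + k1 *: v o1 + k2 *: v o2.
have y'S : y' \in S by rewrite !memvD// memvZ// S_in// !inE eqxx ?orbT.
rewrite -(subrK y' y) memvD//.
have : y - y' \in kerX.
  have adXy' : ad X y' = ad X y by rewrite adXy /y' !linearD !linearZ /= !adE.
  by rewrite memv_ker linearB /= adXy' subrr.
rewrite -(span_basis bC); apply/subvP/span_subvP => z.
by rewrite !inE => /or4P[|||/orP[]] /eqP->; rewrite S_in// !inE eqxx ?orbT.
Qed.

Lemma lker_basis u w0 w1 w2 : basis_of imX [:: w0; w1; w2] ->
  u \in kerX -> u \notin imX -> X \notin (<[u]> + imX)%VS ->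
  basis_of kerX [:: X; u; w0; w1; w2].
Proof.
move=> bI uC uI Xu; have sI := span_basis bI.
have Xu_free : free [:: X; u; w0; w1; w2].
  by rewrite free_cons span_cons sI Xu free_cons sI uI (basis_free bI).
rewrite basisEfree dim_lker Xu_free andbT; apply/span_subvP => z.
have IC := subv_trans limg_derived derived_lker.
rewrite !inE => /or4P[|||/orP[]] /eqP->; rewrite ?mem_lkerX//;
  by apply: (subvP IC); rewrite -sI memv_span// !inE eqxx ?orbT.
Qed.

(** Here u is a vector of W outside the image of ad X.  The brackets cannot all
    lie in this image, so that E <> 0 in the resulting coframe. *)
Lemma symplectic_dim4 : \dim W = 4%N -> symplectic g.
Proof.
move=> dW4.
have [w0 [w1 [w2 bI]]] := basis3_exists rankX.
have [u uW uI] : exists2 u, u \in W & u \notin imX.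
  by apply/subvPn/negP => /dimvS; rewrite dW4 rankX.
pose v := tri ((ad X)^-1%VF w0) ((ad X)^-1%VF w1) ((ad X)^-1%VF w2).
have XvE w : w \in [:: w0; w1; w2] -> [lie X, (ad X)^-1%VF w] = w.
  by move=> w_in; rewrite -adE limg_lfunVK// (basis_mem bI).
have Xv0 : [lie X, v o0] = w0 by apply: XvE; rewrite !inE eqxx.
have Xv1 : [lie X, v o1] = w1 by apply: XvE; rewrite !inE eqxx ?orbT.
have Xv2 : [lie X, v o2] = w2 by apply: XvE; rewrite !inE eqxx ?orbT.
have bC : basis_of kerX [:: X; u; w0; w1; w2].
  apply: lker_basis => //; first exact: (subvP derived_lker).
  by apply: contra XW; apply/subvP; rewrite subv_add -memvE uW limg_derived.
have Wspan : (W <= <<[:: u; w0; w1; w2]>>)%VS.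
  rewrite (_ : W = <<[:: u; w0; w1; w2]>>%VS) //; apply/esym/eqP.
  rewrite span_cons (span_basis bI) eqEdim subv_add -memvE uW limg_derived.
  by rewrite dW4 dim_add_line// rankX.
have v_basis := frame_basis (v := v); rewrite /= Xv0 Xv1 Xv2 in v_basis.
have cent y : [lie u, y] = 0 by rewrite lie_skew central ?oppr0.
have [||i|i j|a [c [b [w [P [cu cw cof]]]]]] :=
    @frame_coframe _ _ nil3 X u v 0; rewrite ?Xv0 ?Xv1 ?Xv2.
- exact: v_basis.
- exact: central.
- by rewrite cent big1// => j _; rewrite mxE scale0r.
- exact: (subvP Wspan _ (derivedP _ _)).
set E := (X in coframe a c b w X) in cof.
apply: (symplectic_coframe4 dim_g cof); apply: contraTneq (oner_neq0 K) => E0.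
rewrite negbK -cu; move: cof; rewrite E0 => cof.
have c_br y z : c [lie y, z] = 0.
  by rewrite (coframe_c cof) /wedge_row !mxE !mul0r !addr0.
suff /dimvS : (W <= imX)%VS by rewrite dW4 rankX.
apply: derived_sub => y z.
have := subvP Wspan _ (derivedP y z); rewrite span_cons (span_basis bI).
case/memv_addP=> [_ /vlineP[k ->] [x xI yzE]]; rewrite yzE memvD//.
move: xI (c_br y z); rewrite yzE -(span_basis bI).
case/mem_span3P=> [[[k0 k1] k2] /= ->].
have c_lin := coframe_c_lin cof.
have := cw o0; have := cw o1; have := cw o2; rewrite Xv0 Xv1 Xv2 => c2 c1 c0.
rewrite c_lin cu scalar_comb3// c0 c1 c2 !mulr0 !addr0 mulr1 => ->.
by rewrite scale0r mem0v.
Qed.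


(** Here W is the image of ad X.  With u_0 completing X and W to a basis of
    ker (ad X), T = ad u_0 o (ad X)^-1 is an endomorphism of W; passing to
    u = u_0 - d X gives T - d one of the four shapes. *)
Lemma symplectic_or_mc8 (h : lieAlgType K) (e : 8.-tuple h) :
  basis_of {:h} e -> maurer_cartan8 e -> \dim W = 3%N ->
  symplectic g \/ lie_isomorphic g h.
Proof.
move=> e_basis e_mc dW3.
have WI : W = imX by apply/esym/eqP; rewrite eqEdim limg_derived dW3 rankX.
have [u0 u0C u0N] : exists2 u, u \in kerX & u \notin (<[X]> + imX)%VS.
  apply/subvPn/negP => /dimvS; rewrite dim_lker dim_add_line -?WI//.
  by rewrite dW3.
pose T := (ad u0 \o (ad X)^-1)%VF.
have TW x : x \in W -> T x \in W by rewrite comp_lfunE adE derivedP.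
have [d] := normal3P dW3 TW; set N := T - _ => normN.
pose u := u0 - d *: X.
have uN : u \notin (<[X]> + imX)%VS.
  apply: contra u0N => uN; rewrite -(subrK (d *: X) u0) memvD//.
  by apply: (subvP (addvSl _ _)); rewrite memvZ ?memv_line.
have uI : u \notin imX by apply: contra uN; apply/subvP; exact: addvSr.
have uC : u \in kerX by rewrite memvB// memvZ// mem_lkerX.
have Xu : X \notin (<[u]> + imX)%VS.
  apply/negP => /memv_addP[_ /vlineP[k ->] [x xI XE]].
  have [k0|k0] := eqVneq k 0.
    by case/negP: XW; rewrite XE k0 scale0r add0r WI.
  case/negP: uN; rewrite -[u](scalerK k0) memvZ//.
  rewrite (_ : k *: u = X - x); last by rewrite XE addrK.
  rewrite memvB// ?(subvP (addvSr _ _) _ xI)// (subvP (addvSl _ _))//.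
  exact: memv_line.
have frame w0 w1 w2 (L : 'M_3) : basis_of W [:: w0; w1; w2] ->
    (forall i, N (tri w0 w1 w2 i) = \sum_j L i j *: tri w0 w1 w2 j) ->
    exists (a c : g -> K) b w P, coframe a c b w 0 L P.
  rewrite {1}WI => bI NL; pose v i := (ad X)^-1%VF (tri w0 w1 w2 i).
  have triI i : tri w0 w1 w2 i \in imX.
    by move: i; apply: forall_ord3; rewrite (basis_mem bI)// !inE eqxx ?orbT.
  have Xv i : [lie X, v i] = tri w0 w1 w2 i by rewrite -adE limg_lfunVK.
  have v_basis := @frame_basis u v; rewrite /= !Xv in v_basis.
  have [||i|i j|a [c [b [w [P [cu cw cof]]]]]] :=
      @frame_coframe _ _ nil3 X u v L; rewrite ?Xv.
  - exact: v_basis (lker_basis bI uC uI Xu).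
  - by rewrite -adE; apply/eqP; rewrite -memv_ker.
  - transitivity (N (tri w0 w1 w2 i)).
      rewrite /N !lfun_simp /= adE -/(v i) linearBl /= linearZl_LR /= Xv//.
    by rewrite NL; apply: eq_bigr => j _; rewrite Xv.
  - rewrite span_cons (subvP (addvSr _ _))// (span_basis bI) -WI.
    exact: derivedP.
  set E := (X in coframe a c b w X) in cof.
  exists a, c, b, w, P; suff <- : E = 0 by [].
  have c_br y z : c [lie y, z] = 0.
    have := derivedP y z; rewrite WI -(span_basis bI).
    case/mem_span3P=> [[[k0 k1] k2] /= ->].
    rewrite (scalar_comb3 _ _ _ _ _ _ (coframe_c_lin cof)).
    have := cw o0; have := cw o1; have := cw o2; rewrite !Xv => -> -> ->.
    by rewrite !mulr0 !addr0.
  by apply/rowP => i; rewrite !mxE !c_br !if_same.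
case: normN => w0 w1 w2.
- move=> bW N0 N1 N2; left.
  have [a [c [b [w [P cof]]]]] : exists (a c : g -> K) b w P,
      coframe a c b w 0 0 P.
    apply: (frame _ _ _ _ bW); apply: forall_ord3;
      by rewrite ?(N0, N1, N2) big1// => j _; rewrite mxE scale0r.
  exact: (symplectic_zero dim_g cof).
- move=> k bW k0 N0 N1 N2.
  have [a [c [b [w [P cof]]]]] : exists (a c : g -> K) b w P,
      coframe a c b w 0 (mx3 [:: [::]; [::]; [:: 0; 0; k]]) P.
    apply: (frame _ _ _ _ bW); apply: forall_ord3;
      by rewrite sum_ord3 !mxE /= ?scale0r ?add0r ?addr0.
  have [|[a' [c' [p [p0 cof']]]]] := symplectic_semisimple dim_g k0 cof.
    by left.
  by right; exact: (mc8_isomorphic e_basis e_mc dim_g k0 p0 cof').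
- move=> bW N0 N1 N2; left.
  have [a [c [b [w [P cof]]]]] : exists (a c : g -> K) b w P,
      coframe a c b w 0 (mx3 [:: [:: 0; 1; 0]; [::]; [::]]) P.
    apply: (frame _ _ _ _ bW); apply: forall_ord3;
      by rewrite sum_ord3 !mxE /= ?scale0r ?scale1r ?add0r ?addr0.
  exact: (symplectic_nilpotent dim_g cof).
move=> bW N0 N1; left.
have : N w2 \in W.
  have w2W : w2 \in W by rewrite (basis_mem bW)// !inE eqxx ?orbT.
  rewrite (_ : N w2 = T w2 - d *: w2) ?memvB ?TW ?memvZ//.
  by rewrite /N !(add_lfunE, opp_lfunE, scale_lfunE, id_lfunE).
rewrite -(span_basis bW) => /mem_span3P[[[l0 l1] l2] /= N2].
have [a [c [b [w [P cof]]]]] : exists (a c : g -> K) b w P, coframe a c b w 0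
    (mx3 [:: [:: 0; 1; 0]; [:: 0; 0; 1]; [:: l0; l1; l2]]) P.
  apply: (frame _ _ _ _ bW); apply: forall_ord3;
    by rewrite sum_ord3 !mxE /= ?scale0r ?scale1r ?add0r ?addr0.
exact: (symplectic_cyclic dim_g cof).
Qed.

End Frames.

Theorem theorem17 (R : realType) (K : fieldType)
    (hK : K = (R : fieldType) \/ K = (R[i]%C : fieldType))
    (g : lieAlgType K)
    (hdim : \dim {:g} = 8%N)
    (hnil : two_step_nilpotent g)
    (hchar : is_char_seq g [:: 2; 2; 2; 1; 1]%N)
    (h : lieAlgType K) (e : 8.-tuple h)
    (he : basis_of {:h} e) (hMC : maurer_cartan8 e) :
  symplectic g <-> ~ lie_isomorphic g h.
Proof.
case: hchar => -[X XW /rank_jordan_22211 rankX] _.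
split=> [symp iso|not_iso].
  exact: (mc8_not_symplectic he hMC (nil3 hnil) iso symp).
have [dW|dW] := dim_derived hdim hnil rankX XW.
  by case: (symplectic_or_mc8 hdim hnil rankX XW he hMC dW).
exact: (symplectic_dim4 hdim hnil rankX XW dW).
Qed.
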